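(* Consider the linear model $\mathbf{y}=\alpha\mathbf{1}_n+\mathbf{X}\boldsymbol{\beta}+\sigma\boldsymbol{\epsilon}$, where the error vector $\boldsymbol{\epsilon}$ has a spherically symmetric density $f(\boldsymbol{\epsilon}'\boldsymbol{\epsilon})$ on $\mathbb{R}^n$ with $E[\boldsymbol{\epsilon}]=\mathbf{0}_n$ and $\mathrm{Var}[\boldsymbol{\epsilon}]=\mathbf{I}_n$, and consider Stein's loss $L_S(\delta,\sigma^2)=\delta/\sigma^2-\log(\delta/\sigma^2)-1$. Let $0<a<p$. Then the generalized Bayes estimator of $\sigma^2$ with respect to the prior $\pi(\alpha,\boldsymbol{\beta},\sigma^2)=(\boldsymbol{\beta}'\mathbf{X}'\mathbf{X}\boldsymbol{\beta})^{-(p-a)/2}\{\sigma^2\}^{-1}$ is $$\delta_a^{GB}=\phi_a^{GB}(R^2)\,\frac{\mathrm{RSS}}{n-p-1},$$ where $$\phi_a^{GB}(R^2)=\frac{n-p-1}{n-a-1}\,\frac{\int_0^1 t^{p/2-a/2-1}(1-t)^{a/2-1}(1-R^2t)^{(n-p-a-1)/2}\,dt}{\int_0^1 t^{p/2-a/2-1}(1-t)^{a/2-1}(1-R^2t)^{(n-p-a+1)/2}\,dt}.$$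
   Context: Here $\mathbf{y}\in\mathbb{R}^n$ is observed, $\alpha\in\mathbb{R}$ is an unknown intercept, $\mathbf{1}_n$ is the $n$-vector of ones, $\mathbf{X}=(\mathbf{x}_1,\dots,\mathbf{x}_p)$ is a known $n\times p$ design matrix whose columns are centered ($\mathbf{x}_i'\mathbf{1}_n=0$) and linearly independent (rank $p$), $n>p+1$, $\boldsymbol{\beta}\in\mathbb{R}^p$ is unknown, and $\sigma>0$ is unknown. With $\bar y$ the mean of the entries of $\mathbf{y}$, $\mathrm{RSS}=\|(\mathbf{I}-\mathbf{X}(\mathbf{X}'\mathbf{X})^{-1}\mathbf{X}')(\mathbf{y}-\bar y\mathbf{1}_n)\|^2$ and $R^2=\|\mathbf{X}(\mathbf{X}'\mathbf{X})^{-1}\mathbf{X}'(\mathbf{y}-\bar y\mathbf{1}_n)\|^2/\|\mathbf{y}-\bar y\mathbf{1}_n\|^2$ (the coefficient of determination). The generalized Bayes estimator under Stein's loss is $\{E[1/\sigma^2\mid\mathbf{y}]\}^{-1}$, computed with respect to the (improper) posterior from the likelihood $\sigma^{-n}f(\|\mathbf{y}-\alpha\mathbf{1}_n-\mathbf{X}\boldsymbol{\beta}\|^2/\sigma^2)$ and the given prior. *)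

(* Defs.v *)
From HB Require Import structures.
From mathcomp Require Import all_boot all_order all_algebra.
From mathcomp Require Import all_classical all_reals all_analysis.
Set Implicit Arguments. Unset Strict Implicit. Unset Printing Implicit Defensive.
Import Order.TTheory GRing.Theory Num.Theory.
Local Open Scope ring_scope.
Local Open Scope classical_set_scope.

Section Defs.
Variable R : realType.

(* Lebesgue integral over R^n (column vectors), as the iterated one-dimensional
   Lebesgue integral (by Tonelli/Fubini this is the integral w.r.t. Lebesgue
   measure on R^n for nonnegative, resp. absolutely integrable, integrands). *)
Fixpoint intRn (n : nat) : ('cV[R]_n -> \bar R) -> \bar R :=
  match n return ('cV[R]_n -> \bar R) -> \bar R with
  | 0 => fun F => F 0
  | m.+1 => fun F =>
      (\int[@lebesgue_measure R]_x intRn (fun v : 'cV[R]_m => F (col_mx (x%:M) v)))%E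
  end.

Definition ones (n : nat) : 'cV[R]_n := const_mx 1.
Definition sqnorm (n : nat) (v : 'cV[R]_n) : R := \sum_i (v i 0) ^+ 2.
Definition ybar (n : nat) (y : 'cV[R]_n) : R := (\sum_i y i 0) / n%:R.
Definition ycent (n : nat) (y : 'cV[R]_n) : 'cV[R]_n := y - ybar y *: ones n.
Definition hatmx (n p : nat) (X : 'M[R]_(n, p)) : 'M[R]_n :=
  X *m invmx (X^T *m X) *m X^T.
Definition RSS (n p : nat) (X : 'M[R]_(n, p)) (y : 'cV[R]_n) : R :=
  sqnorm ((1%:M - hatmx X) *m ycent y).
Definition Rsq (n p : nat) (X : 'M[R]_(n, p)) (y : 'cV[R]_n) : R :=
  sqnorm (hatmx X *m ycent y) / sqnorm (ycent y).

(* unnormalized posterior integral of sigma^{-2k}, k = 0 or 1, under the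
   likelihood sigma^{-n} f(||y - alpha 1 - X beta||^2 / sigma^2) and the prior
   (beta'X'X beta)^{-(p-a)/2} (sigma^2)^{-1}; integration variables
   alpha in R, beta in R^p, v = sigma^2 in (0, +oo). *)
Definition post_int (n p : nat) (X : 'M[R]_(n, p)) (y : 'cV[R]_n)
    (f : R -> R) (a : R) (k : nat) : \bar R :=
  (\int[@lebesgue_measure R]_alpha
     intRn (fun beta : 'cV[R]_p =>
       \int[@lebesgue_measure R]_(v in [set v : R | (0 < v)%R])
         ((powR v (- (n%:R / 2)) * f (sqnorm (y - alpha *: ones n - X *m beta) / v)
          * powR (sqnorm (X *m beta)) (- ((p%:R - a) / 2)) * v^-1
          * v ^- k)%R)%:E))%E.

(* generalized Bayes estimator under Stein's loss: {E[1/sigma^2 | y]}^{-1}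
   = (posterior integral of 1) / (posterior integral of sigma^{-2}) *)
Definition delta_GB (n p : nat) (X : 'M[R]_(n, p)) (y : 'cV[R]_n)
    (f : R -> R) (a : R) : R :=
  fine (post_int X y f a 0) / fine (post_int X y f a 1).

Definition phi_GB (n p : nat) (a r2 : R) : R :=
  (n%:R - p%:R - 1) / (n%:R - a - 1) *
  (Rintegral (@lebesgue_measure R) `[(0:R), 1]
     (fun t => powR t (p%:R / 2 - a / 2 - 1) * powR (1 - t) (a / 2 - 1)
               * powR (1 - r2 * t) ((n%:R - p%:R - a - 1) / 2))
   / Rintegral (@lebesgue_measure R) `[(0:R), 1]
     (fun t => powR t (p%:R / 2 - a / 2 - 1) * powR (1 - t) (a / 2 - 1)
               * powR (1 - r2 * t) ((n%:R - p%:R - a + 1) / 2))).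

End Defs.

(* Main.v *)
Require Import Defs.
From HB Require Import structures.
From mathcomp Require Import all_boot all_order all_algebra.
From mathcomp Require Import all_classical all_reals all_analysis.
From mathcomp Require Import measurable_realfun measurable_fun_approximation ring lra.
Set Implicit Arguments. Unset Strict Implicit. Unset Printing Implicit Defensive.
Import Order.TTheory GRing.Theory Num.Theory.
Local Open Scope ring_scope.
Local Open Scope classical_set_scope.

(** Least squares splits [|y - alpha 1 - X beta|^2] as
    [s = n (alpha - ybar)^2 + RSS + |X (beta - bhat)|^2].  The scaling [v = s w]
    separates [f] from the rest: the posterior integral of [sigma^(-2k)] is
    [P_k Q_k], where [P_k = \int f(1/v) v^(-n/2-k-1) dv] is a fixed multiple of
    [E|eps|^(2k)], so that [P_1 = n P_0], and [Q_k] is the integral of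
    [s^(-n/2-k) |X beta|^(-(p-a))].  Writing both powers in [Q_k] as Gamma
    integrals, in [h] and [g], makes the integral over [(alpha, beta)] Gaussian;
    the substitutions [g = h q], [q = (1 - R^2) r], [r = t / (1 - t)] turn what is
    left into [RSS^(-(n-a-1)/2-k)] times the integrals in [phi].  The functional
    equation of Gamma gives the factor [n - a - 1].  All integrands are
    nonnegative, so every interchange is an instance of Tonelli's theorem. *)

(** Constants common to both posterior integrals, such as the integral of [exp(-|X b|^2)], are never
    evaluated: they cancel in the ratio, and only their positivity and finiteness matter. Hence
    translations and scalings suffice in [R^m], with no determinant and no polar coordinates; the
    radial integral [P_k] is tied to [E|eps|^(2k)] by a swap against a Gaussian weight.

    The identities hold in the extended reals, where [Gamma] and [P_k] leave an integral before they
    are known to be finite. Finiteness of [P_k] and [Q_k] comes last, when an identity with a finite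
    side is divided by a positive finite factor.

    The origin is an obstacle: [powR 0 x] is [0] for every nonzero [x], so the Gamma representation
    of a power of [|X beta|] fails at [beta = 0]. Such identities are used off the origin, a null
    set because [0 < a < p] forces [p > 0].

    The [n] of [P_1 = n P_0] cancels against [Gamma (n/2 + 1) = (n/2) Gamma (n/2)]. The [2] that
    remains multiplies the [M = (n-a-1)/2] from [Gamma (M + 1) = M Gamma M], and [2 M] is the factor
    [n - a - 1]. *)

(** * Affine substitutions on the line *)

Section Substitution.
Variable R : realType.
Local Notation mu := (@lebesgue_measure R).
Local Open Scope ereal_scope.

(** The pushforward of Lebesgue measure under the translation gives half-open intervals their
    length, so it is Lebesgue measure by uniqueness. *)
Lemma ge0_integral_translation (c : R) (F : R -> \bar R) :
  measurable_fun [set: R] F -> (forall x, 0 <= F x) ->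
  \int[mu]_x F (x + c)%R = \int[mu]_x F x.
Proof.
move=> mF F0.
have mphi : measurable_fun setT (fun x : measurableTypeR R => ((x : R) + c)%R : measurableTypeR R).
  exact: measurable_funD.
have := ge0_integral_pushforward mphi mu (D := setT) (f := F) measurableT mF (fun x _ => F0 x).
rewrite preimage_setT => <-.
apply: eq_measure_integral => //= A mA _.
apply/esym/lebesgue_measure_unique => //= _ [[a b]] _ <-.
rewrite /pushforward [X in _ = mu X](_ : _ = `](a - c)%R, (b - c)%R]%classic).
  rewrite !lebesgue_measure_itv/= !lte_fin ltrD2r.
  by case: ifP => // _; rewrite -!EFinB; congr EFin; ring.
by apply/seteqP; split => x /=; rewrite !in_itv/= ltrBlDr lerBrDr.
Qed.

(** The same uniqueness argument, applied to [c] times the pushforward under multiplication by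
    [c]. *)
Lemma ge0_integral_scaling (c : R) (F : R -> \bar R) : (0 < c)%R ->
  measurable_fun [set: R] F -> (forall x, 0 <= F x) ->
  \int[mu]_x F x = c%:E * \int[mu]_x F (c * x)%R.
Proof.
move=> c0 mF F0.
have mphi : measurable_fun setT (fun x : measurableTypeR R => (c * (x : R))%R : measurableTypeR R).
  exact: measurable_funM.
pose cn := NngNum (ltW c0).
have := ge0_integral_pushforward mphi mu (D := setT) (f := F) measurableT mF (fun x _ => F0 x).
rewrite preimage_setT => <-.
rewrite -[c]/(cn%:num)%R -ge0_integral_mscale//.
apply: eq_measure_integral => //= A mA _.
apply: lebesgue_measure_unique => //= _ [[a b]] _ <-.
rewrite /mscale/= /pushforward.
rewrite [X in _ = _ * mu X](_ : _ = `](c^-1 * a)%R, (c^-1 * b)%R]%classic).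
  rewrite !lebesgue_measure_itv/= !lte_fin ltr_pM2l ?invr_gt0//.
  case: ifP => _; rewrite ?mule0// -!EFinB -EFinM; congr EFin.
  by field; rewrite gt_eqF.
apply/seteqP; split => x /=; rewrite !in_itv/= => /andP[h1 h2]; apply/andP; split.
- by rewrite -(ltr_pM2l c0) mulrA divff ?gt_eqF// mul1r.
- by rewrite -(ler_pM2l c0) mulrA divff ?gt_eqF// mul1r.
- by rewrite -(ltr_pM2l c0) mulrA divff ?gt_eqF// mul1r in h1.
- by rewrite -(ler_pM2l c0) mulrA divff ?gt_eqF// mul1r in h2.
Qed.

Lemma ge0_integral_scaling_pos (c : R) (F : R -> \bar R) : (0 < c)%R ->
  measurable_fun [set: R] F -> (forall x, 0 <= F x) ->
  \int[mu]_(x in `]0%R, +oo[) F x =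
  c%:E * \int[mu]_(x in `]0%R, +oo[) F (c * x)%R.
Proof.
move=> c0 mF F0.
rewrite integral_mkcond (ge0_integral_scaling c0).
- rewrite [in RHS]integral_mkcond; congr (_ * _); apply: eq_integral => x _.
  by rewrite !patchE !mem_setE !in_itv/= !andbT pmulr_rgt0.
- exact/(measurable_restrictT _ (measurable_itv _))/measurable_funTS.
- by move=> x; rewrite patchE; case: ifP.
Qed.

End Substitution.

(** * Tonelli's theorem for integrals over subsets *)

Section TonelliRestricted.
Context d1 d2 (T1 : measurableType d1) (T2 : measurableType d2) (R : realType).
Variable m1 : {sigma_finite_measure set T1 -> \bar R}.
Variable m2 : {sigma_finite_measure set T2 -> \bar R}.
Local Open Scope ereal_scope.

Lemma ge0_integral_swap (D : set T1) (E : set T2) (F : T1 -> T2 -> \bar R) :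
  measurable D -> measurable E ->
  measurable_fun setT (fun z => F z.1 z.2) -> (forall x y, 0 <= F x y) ->
  \int[m1]_(x in D) \int[m2]_(y in E) F x y =
  \int[m2]_(y in E) \int[m1]_(x in D) F x y.
Proof.
move=> mD mE mF F0.
pose G := (fun z : T1 * T2 => F z.1 z.2) \_ (D `*` E).
have mG : measurable_fun setT G.
  by apply/(measurable_restrictT _ (measurableX mD mE))/measurable_funTS.
have G0 z : 0 <= G z by rewrite /G patchE; case: ifP.
have GE := fubini_tonelli (m1 := m1) (m2 := m2) G mG G0.
rewrite integral_mkcond [in RHS]integral_mkcond.
transitivity (\int[m1]_x \int[m2]_y G (x, y)).
  apply: eq_integral => x _; rewrite patchE; case: ifPn => xD.
    rewrite integral_mkcond; apply: eq_integral => y _.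
    by rewrite /G !patchE in_setX xD.
  by rewrite integral0_eq// => y _; rewrite /G patchE in_setX (negPf xD).
rewrite GE; apply: eq_integral => y _; rewrite patchE; case: ifPn => yE.
  rewrite [RHS]integral_mkcond; apply: eq_integral => x _.
  by rewrite /G !patchE in_setX yE andbT.
by rewrite integral0_eq// => x _; rewrite /G patchE in_setX (negPf yE) andbF.
Qed.

Lemma ge0_measurable_integral_r (E : set T2) (F : T1 -> T2 -> \bar R) :
  measurable E ->
  measurable_fun setT (fun z => F z.1 z.2) -> (forall x y, 0 <= F x y) ->
  measurable_fun setT (fun x => \int[m2]_(y in E) F x y).
Proof.
move=> mE mF F0.
pose G := (fun z : T1 * T2 => F z.1 z.2) \_ ([set: T1] `*` E).
have mG : measurable_fun setT G.
  by apply/(measurable_restrictT _ (measurableX measurableT mE))/measurable_funTS.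
have G0 z : 0 <= G z by rewrite /G patchE; case: ifP.
apply: eq_measurable_fun (measurable_fun_fubini_tonelli_F (m2 := m2) G mG G0).
move=> x _; rewrite /fubini_F [RHS]integral_mkcond; apply: eq_integral => y _.
by rewrite /G !patchE in_setX in_setT.
Qed.

End TonelliRestricted.

(** * Calculus of the iterated integral over column vectors *)

Section IteratedIntegral.
Variable R : realType.
Local Notation mu := (@lebesgue_measure R).
Implicit Type m : nat.

Definition colt m (s : m.-tuple R) : 'cV[R]_m := \col_i tnth s i.

(* Joint measurability of [F] in a parameter and a column vector, the latter
   read as a tuple since matrices carry no sigma-algebra. *)
Definition col_measurable d (T : measurableType d) m
    (F : T -> 'cV[R]_m -> \bar R) :=
  measurable_fun setT (fun z : T * m.-tuple R => F z.1 (colt z.2)).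

Definition col_measurable0 m (F : 'cV[R]_m -> \bar R) :=
  measurable_fun setT (fun s : m.-tuple R => F (colt s)).

Lemma colt_cons m (x : R) (s : m.-tuple R) :
  colt [tuple of x :: s] = col_mx x%:M (colt s) :> 'cV[R]_(1 + m).
Proof.
apply/matrixP => i j; rewrite ord1 !mxE.
case: splitP => [k|k] ik.
  rewrite ord1 mxE eqxx mulr1n (_ : i = ord0) ?tnth0//.
  by apply/val_inj => /=; rewrite ik ord1.
by rewrite mxE (_ : i = lift ord0 k) ?tnthS//; exact/val_inj.
Qed.

Section ParameterSection.
Context d (T : measurableType d).

(** Moving the first coordinate into the parameter is the step that drives the inductions on the
    dimension. *)
Lemma col_measurable_cons m (F : T -> 'cV[R]_m.+1 -> \bar R) :
  col_measurable F ->
  col_measurable (fun (tx : T * R) (v : 'cV[R]_m) =>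
    F tx.1 (col_mx tx.2%:M v : 'cV[R]_(1 + m))).
Proof.
move=> mF; rewrite /col_measurable.
have mg : measurable_fun setT (fun z : (T * R) * m.-tuple R =>
    (z.1.1, [tuple of z.1.2 :: z.2])).
  apply: measurable_fun_pair; first exact: measurableT_comp.
  by apply: measurable_cons => //; exact: measurableT_comp.
have := measurableT_comp mF mg; apply: eq_measurable_fun => z _ /=.
by rewrite colt_cons.
Qed.

Lemma col_measurable_section m (F : T -> 'cV[R]_m -> \bar R) t :
  col_measurable F -> col_measurable0 (F t).
Proof.
move=> mF; have mg : measurable_fun setT (fun s : m.-tuple R => (t, s)).
  exact: measurable_fun_pair.
exact: (measurableT_comp mF mg).
Qed.

End ParameterSection.

Lemma col_measurable0_cons m (F : 'cV[R]_m.+1 -> \bar R) :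
  col_measurable0 F ->
  col_measurable (fun (x : R) (v : 'cV[R]_m) =>
    F (col_mx x%:M v : 'cV[R]_(1 + m))).
Proof.
move=> mF; rewrite /col_measurable.
have mg : measurable_fun setT (fun z : R * m.-tuple R =>
    [tuple of z.1 :: z.2]) by exact: measurable_cons.
have := measurableT_comp mF mg; apply: eq_measurable_fun => z _ /=.
by rewrite colt_cons.
Qed.

Local Open Scope ereal_scope.

Lemma eq_intRn m (F G : 'cV[R]_m -> \bar R) :
  (forall v, F v = G v) -> intRn F = intRn G.
Proof. by move=> FG; congr intRn; exact/funext. Qed.

Lemma intRn_ge0 m (F : 'cV[R]_m -> \bar R) :
  (forall v, 0 <= F v) -> 0 <= intRn F.
Proof.
elim: m F => [|m IH] F F0 /=; first exact: F0.
by apply: integral_ge0 => x _; apply: IH.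
Qed.

(** The induction generalises the parameter space, because peeling off a coordinate turns [T] into
    [T * R]. *)
Lemma measurable_intRn d (T : measurableType d) m
    (F : T -> 'cV[R]_m -> \bar R) :
  col_measurable F -> (forall t v, 0 <= F t v) ->
  measurable_fun setT (fun t => intRn (F t)).
Proof.
elim: m d T F => [|m IH] d T F mF F0 /=.
  have mg : measurable_fun setT (fun t : T => (t, [tuple] : 0.-tuple R)).
    exact: measurable_fun_pair.
  have := measurableT_comp mF mg; apply: eq_measurable_fun => t _ /=.
  by congr (F t _); apply/matrixP => -[].
apply: (@ge0_measurable_integral_r _ _ T _ R mu setT
  (fun t x => intRn (fun v : 'cV[R]_m => F t (col_mx x%:M v : 'cV[R]_(1 + m))))) => //.
  by apply: IH => //; exact: col_measurable_cons.
by move=> t x; exact: intRn_ge0.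
Qed.

Lemma measurable_intRn_cons m (F : 'cV[R]_m.+1 -> \bar R) :
  col_measurable0 F -> (forall v, 0 <= F v) ->
  measurable_fun setT (fun x : R =>
    intRn (fun v : 'cV[R]_m => F (col_mx x%:M v : 'cV[R]_(1 + m)))).
Proof.
by move=> mF F0; apply: measurable_intRn => //; exact: col_measurable0_cons.
Qed.

Lemma intRn_swap d (T : measurableType d)
    (nu : {sigma_finite_measure set T -> \bar R}) (D : set T) m
    (F : T -> 'cV[R]_m -> \bar R) :
  measurable D -> col_measurable F -> (forall t v, 0 <= F t v) ->
  \int[nu]_(t in D) intRn (F t) = intRn (fun v => \int[nu]_(t in D) F t v).
Proof.
move=> mD; elim: m F => [//|m IH] F mF F0 /=.
have mF' := col_measurable_cons mF.
rewrite (@ge0_integral_swap _ _ _ _ _ nu mu D setT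
  (fun t x => intRn (fun v : 'cV[R]_m => F t (col_mx x%:M v : 'cV[R]_(1 + m)))))//.
- apply: eq_integral => x _; apply: IH => //.
  have mg : measurable_fun setT (fun z : T * m.-tuple R => ((z.1, x), z.2)).
    by apply: measurable_fun_pair => //; exact: measurable_fun_pair.
  exact: (measurableT_comp mF' mg).
- exact: measurable_intRn.
- by move=> t x; exact: intRn_ge0.
Qed.

(** The factor is an extended real so that [Gamma] and [radial_mass] can be pulled out before they
    are known to be finite. *)
Lemma intRnZl m (k : \bar R) (F : 'cV[R]_m -> \bar R) :
  0 <= k -> col_measurable0 F -> (forall v, 0 <= F v) ->
  intRn (fun v => k * F v) = k * intRn F.
Proof.
move=> k0; elim: m F => [//|m IH] F mF F0 /=.
rewrite -ge0_integralZl//.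
- apply: eq_integral => x _; rewrite IH//.
  exact: (col_measurable_section _ (col_measurable0_cons mF)).
- exact: measurable_intRn_cons.
- by move=> x _; exact: intRn_ge0.
Qed.

Lemma le_intRn m (F G : 'cV[R]_m -> \bar R) :
  col_measurable0 F -> col_measurable0 G -> (forall v, 0 <= F v) ->
  (forall v, F v <= G v) -> intRn F <= intRn G.
Proof.
elim: m F G => [|m IH] F G mF mG F0 FG /=; first exact: FG.
have G0 v : 0 <= G v by exact: le_trans (FG v).
apply: ge0_le_integral => //.
- by move=> x _; exact: intRn_ge0.
- exact: measurable_intRn_cons.
- exact: measurable_intRn_cons.
- move=> x _; apply: IH => //.
  + exact: (col_measurable_section _ (col_measurable0_cons mF)).
  + exact: (col_measurable_section _ (col_measurable0_cons mG)).
Qed.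

Lemma intRnD m (F G : 'cV[R]_m -> \bar R) :
  col_measurable0 F -> col_measurable0 G ->
  (forall v, 0 <= F v) -> (forall v, 0 <= G v) ->
  intRn (fun v => F v + G v) = intRn F + intRn G.
Proof.
elim: m F G => [//|m IH] F G mF mG F0 G0 /=.
rewrite -ge0_integralD//.
- apply: eq_integral => x _; apply: IH => //.
  + exact: (col_measurable_section _ (col_measurable0_cons mF)).
  + exact: (col_measurable_section _ (col_measurable0_cons mG)).
- by move=> x _; exact: intRn_ge0.
- exact: measurable_intRn_cons.
- by move=> x _; exact: intRn_ge0.
- exact: measurable_intRn_cons.
Qed.

Lemma intRn0 m : intRn (fun _ : 'cV[R]_m => 0) = 0.
Proof. by elim: m => [//|m IH] /=; rewrite integral0_eq// => x _; rewrite IH. Qed.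

Lemma intRn_sum m (I : Type) (r : seq I) (F : I -> 'cV[R]_m -> \bar R) :
  (forall i, col_measurable0 (F i)) -> (forall i v, 0 <= F i v) ->
  intRn (fun v => \sum_(i <- r) F i v) = \sum_(i <- r) intRn (F i).
Proof.
move=> mF F0; elim: r => [|i r IH].
  by rewrite big_nil -[RHS](intRn0 m); apply: eq_intRn => v; rewrite big_nil.
rewrite big_cons -IH -intRnD//.
- by apply: eq_intRn => v; rewrite big_cons.
- by apply: emeasurable_sum => i'; exact: mF.
- by move=> v; exact: sume_ge0.
Qed.

Lemma col_measurable0_translation m (w : 'cV[R]_m) (F : 'cV[R]_m -> \bar R) :
  col_measurable0 F -> col_measurable0 (fun v => F (v + w)%R).
Proof.
move=> mF.
have mg : measurable_fun setT (fun s : m.-tuple R =>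
    [tuple (tnth s i + w i ord0)%R | i < m]).
  apply/measurable_fun_tnthP => i /=.
  apply: (eq_measurable_fun (fun s : m.-tuple R => (tnth s i + w i ord0)%R)).
    by move=> s _ /=; rewrite tnth_mktuple.
  by apply: measurable_funD => //; exact: measurable_tnth.
have := measurableT_comp mF mg; apply: eq_measurable_fun => s _ /=.
by congr F; apply/matrixP => i j; rewrite !ord1 !mxE tnth_mktuple.
Qed.

Lemma intRn_translation m (w : 'cV[R]_m) (F : 'cV[R]_m -> \bar R) :
  col_measurable0 F -> (forall v, 0 <= F v) ->
  intRn (fun v => F (v + w)%R) = intRn F.
Proof.
elim: m w F => [|m IH] w F mF F0 /=.
  by congr F; apply/matrixP => -[].
pose w1 := @usubmx _ 1 m 1 w; pose w2 := @dsubmx _ 1 m 1 w.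
rewrite -[RHS](@ge0_integral_translation _ (w1 ord0 ord0))//.
- apply: eq_integral => x _.
  rewrite -(IH w2 (fun v => F (col_mx (x + w1 ord0 ord0)%:M v : 'cV[R]_(1 + m))))//.
    apply: eq_intRn => v.
    suff : ((col_mx x%:M v : 'cV[R]_(1 + m)) + (w : 'cV[R]_(1 + m)) =
        col_mx (x + w1 ord0 ord0)%:M (v + w2))%R by move/(congr1 F).
    rewrite -[w in LHS](@vsubmxK _ 1 m 1) add_col_mx; congr col_mx.
    by apply/matrixP => i j; rewrite !ord1 !mxE eqxx !mulr1n.
  exact: (col_measurable_section _ (col_measurable0_cons mF)).
- exact: measurable_intRn_cons.
- by move=> x; exact: intRn_ge0.
Qed.

Lemma col_measurable0_scaling m (c : R) (F : 'cV[R]_m -> \bar R) :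
  col_measurable0 F -> col_measurable0 (fun v => F (c *: v)%R).
Proof.
move=> mF.
have mg : measurable_fun setT (fun s : m.-tuple R =>
    [tuple (c * tnth s i)%R | i < m]).
  apply/measurable_fun_tnthP => i /=.
  apply: (eq_measurable_fun (fun s : m.-tuple R => (c * tnth s i)%R)).
    by move=> s _ /=; rewrite tnth_mktuple.
  by apply: measurable_funM => //; exact: measurable_tnth.
have := measurableT_comp mF mg; apply: eq_measurable_fun => s _ /=.
by congr F; apply/matrixP => i j; rewrite !ord1 !mxE tnth_mktuple.
Qed.

Lemma intRn_scaling m (c : R) (F : 'cV[R]_m -> \bar R) : (0 < c)%R ->
  col_measurable0 F -> (forall v, 0 <= F v) ->
  intRn F = (c ^+ m)%:E * intRn (fun v => F (c *: v)%R).
Proof.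
move=> c0; elim: m F => [|m IH] F mF F0 /=.
  by rewrite expr0 mul1e; congr F; apply/matrixP => -[].
have mFc := col_measurable0_scaling c mF.
rewrite (ge0_integral_scaling c0)//.
- rewrite exprS EFinM -muleA; congr (_ * _); rewrite -ge0_integralZl//.
  + apply: eq_integral => x _; rewrite IH//; last first.
      exact: (col_measurable_section _ (col_measurable0_cons mF)).
    congr (_ * _); apply: eq_intRn => v.
    suff : (col_mx (c * x)%:M (c *: v) =
        c *: (col_mx x%:M v : 'cV[R]_(1 + m)))%R by move/(congr1 F).
    rewrite [RHS]scale_col_mx; congr col_mx.
    by apply/matrixP => i j; rewrite !ord1 !mxE eqxx !mulr1n.
  + exact: (measurable_intRn_cons mFc).
  + by move=> x _; exact: intRn_ge0.
  + by rewrite lee_fin exprn_ge0// ltW.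
- exact: measurable_intRn_cons.
- by move=> x; exact: intRn_ge0.
Qed.

(** A vector with nonzero first coordinate is nonzero, so it is enough to drop the null set [x = 0]
    from the outermost integral; this needs at least one coordinate. It disposes of the value of
    [powR] at [0]. *)
Lemma eq_intRn_off0 m (F G : 'cV[R]_m -> \bar R) : (0 < m)%N ->
  col_measurable0 F -> col_measurable0 G ->
  (forall v, 0 <= F v) -> (forall v, 0 <= G v) ->
  (forall v, v != 0%R -> F v = G v) -> intRn F = intRn G.
Proof.
case: m F G => [//|m] F G _ mF mG F0 G0 FG /=.
have mD : measurable ([set: R] `\ 0%R) by exact: measurableD.
rewrite -(@integral_setD1 _ _ 0%R setT)//; last first.
  by apply: measurable_funTS; exact: measurable_intRn_cons.
rewrite -[RHS](@integral_setD1 _ _ 0%R setT)//; last first.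
  by apply: measurable_funTS; exact: measurable_intRn_cons.
apply: eq_integral => x; rewrite inE => -[_ /= x0]; apply: eq_intRn => v.
apply: FG; apply: contra_not_neq x0 => xv0.
have : (col_mx x%:M v : 'cV[R]_(1 + m)) (lshift m ord0) ord0 = 0%R.
  transitivity ((0%R : 'cV[R]_m.+1) (lshift m ord0 : 'I_(1 + m)) ord0).
    exact: (congr1 (fun u : 'cV[R]_m.+1 =>
      u (lshift m ord0 : 'I_(1 + m)) ord0) xv0).
  by rewrite mxE.
by rewrite col_mxEu !mxE eqxx mulr1n.
Qed.

End IteratedIntegral.

(** * Measurability of explicit integrands *)

Section MeasurableExpressions.
Context d (T : measurableType d) (R : realType).
Implicit Types g h : T -> R.

Lemma measurable_fun_powR g p : measurable_fun setT g ->
  measurable_fun setT (fun x => powR (g x) p).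
Proof. exact: (measurableT_comp (measurable_powR p)). Qed.

Lemma measurable_fun_expR g : measurable_fun setT g ->
  measurable_fun setT (fun x => expR (g x)).
Proof. exact: (measurableT_comp (@measurable_expR R)). Qed.

Lemma measurable_fun_EFin g : measurable_fun setT g ->
  measurable_fun setT (fun x => (g x)%:E).
Proof. by move=> mg; exact/measurable_EFinP. Qed.

Lemma measurable_fun_addr g h : measurable_fun setT g -> measurable_fun setT h ->
  measurable_fun setT (fun x => g x + h x).
Proof. exact: measurable_funD. Qed.

Lemma measurable_fun_mulr g h : measurable_fun setT g -> measurable_fun setT h ->
  measurable_fun setT (fun x => g x * h x).
Proof. exact: measurable_funM. Qed.

Lemma measurable_fun_oppr g : measurable_fun setT g ->
  measurable_fun setT (fun x => - g x).
Proof. exact: measurable_funN. Qed.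

End MeasurableExpressions.

(** Descends through sums, products, [powR] and [expR]. The leaves are constants, projections and
    facts in the context, hence the anonymous measurability facts introduced before its calls. *)
Ltac measurability := repeat (cbv beta; match goal with
  | |- measurable_fun _ (fun x => (@?g x)%:E) => apply: measurable_fun_EFin
  | |- measurable_fun _ (fun x => powR (@?g x) ?p) => apply: measurable_fun_powR
  | |- measurable_fun _ (fun x => expR (@?g x)) => apply: measurable_fun_expR
  | |- measurable_fun _ (fun x => (@?g x + @?h x)%R) => apply: measurable_fun_addr
  | |- measurable_fun _ (fun x => (@?g x * @?h x)%R) => apply: measurable_fun_mulr
  | |- measurable_fun _ (fun x => (- @?g x)%R) => apply: measurable_fun_oppr
  | _ => first
    [ assumption | exact: measurable_cst | exact: measurable_id
    | exact: measurable_fst | exact: measurable_snd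
    | (apply: measurableT_comp; [exact: measurable_fst|])
    | (apply: measurableT_comp; [exact: measurable_snd|])
    | apply: measurable_fun_EFin | apply: measurable_fun_powR
    | apply: measurable_fun_expR | apply: measurable_fun_addr
    | apply: measurable_fun_mulr | apply: measurable_fun_oppr ]
  end).

(** * The Gamma function and the beta prime integral *)

Section OneDimensional.
Import numFieldNormedType.Exports.
Variable R : realType.
Local Notation mu := (@lebesgue_measure R).
Local Notation pos := (`]0%R, +oo[ : set R).
Implicit Types (x s h u : R).

Lemma posP x : pos x <-> 0 < x.
Proof. by rewrite /= in_itv/= andbT. Qed.

Lemma powR_inv_mul s x : 0 < s -> s^-1 * powR s^-1 (x - 1) = powR s (- x).
Proof.
move=> s0; rewrite -(powR_inv1 (ltW s0)) -powRrM -powRD.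
  by congr powR; ring.
by rewrite (gt_eqF s0) implybT.
Qed.

Local Open Scope ereal_scope.

(** A zero integral would make [F] vanish almost everywhere on [D], which would put [D] inside a
    null set. *)
Lemma integral_gt0 d (T : measurableType d) (nu : {measure set T -> \bar R})
    (D : set T) (F : T -> \bar R) :
  measurable D -> nu D != 0 -> measurable_fun D F ->
  (forall t, D t -> 0 < F t) -> 0 < \int[nu]_(x in D) F x.
Proof.
move=> mD nD mF F0.
rewrite lt0e; apply/andP; split; last by apply: integral_ge0 => t /F0/ltW.
apply: contra nD => /eqP I0; apply/eqP.
have /(ae_eq_integral_abs nu mD mF) [N [mN N0 DN]] :
    \int[nu]_(x in D) `|F x| = 0.
  rewrite -I0; apply: eq_integral => t /[!inE] Dt.
  by rewrite gee0_abs// ltW// F0.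
apply/eqP; rewrite -measure_le0 -N0; apply: le_measure; rewrite ?inE//.
move=> t Dt; apply: DN => /= /(_ Dt) Ft0.
by have := F0 _ Dt; rewrite Ft0 ltxx.
Qed.

Lemma lebesgue_measure_pos : mu pos != 0.
Proof. by rewrite lebesgue_measure_itv/= ltry. Qed.

Definition Gamma x : \bar R :=
  \int[mu]_(h in pos) (powR h (x - 1) * expR (- h))%:E.

(** Read from right to left, this replaces the power [s^(-x)] by an integral of exponentials in [s].
    In the extended reals it holds for every real [x]. *)
Lemma Gamma_scaling x s : (0 < s)%R ->
  \int[mu]_(h in pos) (powR h (x - 1) * expR (- (s * h)))%:E =
  (powR s (- x))%:E * Gamma x.
Proof.
move=> s0; have si0 : (0 < s^-1)%R by rewrite invr_gt0.
rewrite (ge0_integral_scaling_pos si0).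
- rewrite /Gamma -(powR_inv_mul x s0) EFinM -muleA; congr (_ * _).
  rewrite -ge0_integralZl//.
  + apply: eq_integral => h /[!inE] /posP h0.
    rewrite powRM ?(ltW h0) ?(ltW si0)// mulrA divff ?gt_eqF// mul1r.
    by rewrite -EFinM mulrA.
  + by apply: measurable_funTS; measurability.
  + by move=> h _; rewrite lee_fin mulr_ge0 ?powR_ge0 ?expR_ge0.
  + by rewrite lee_fin powR_ge0.
- by measurability.
- by move=> h; rewrite lee_fin mulr_ge0 ?powR_ge0 ?expR_ge0.
Qed.

Lemma Gamma_gt0 x : 0 < Gamma x.
Proof.
apply: integral_gt0 => //; first exact: lebesgue_measure_pos.
  by apply: measurable_funTS; measurability.
by move=> h /posP h0; rewrite lte_fin mulr_gt0 ?powR_gt0 ?expR_gt0.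
Qed.

Lemma Gamma1 : Gamma 1 = 1.
Proof.
rewrite -(integral_exponential_pdf (@ltr01 R)).
transitivity (\int[mu]_(h in `[0%R, +oo[) (exponential_pdf 1 h)%:E).
  rewrite /Gamma integral_itv_obnd_cbnd; last first.
    by apply: measurable_funTS; measurability.
  apply: eq_integral => h; rewrite inE/= in_itv/= andbT => h0.
  by rewrite exponential_pdfE// subrr powRr0 !mul1r mulN1r.
rewrite integral_mkcond; apply: eq_integral => h _.
rewrite patchE /exponential_pdf patchE.
have [h0|h0] := leP 0%R h; [rewrite !ifT | rewrite !ifF]; rewrite ?mem_setE ?in_itv/= ?h0 ?andbT ?(lt_geF h0)//.
Qed.

Lemma cvg_powRN x : (0 < x)%R -> (powR r (- x) @[r --> +oo] --> 0)%R.
Proof.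
move=> x0; apply: (@cvg_trans _ ((expR (- (ln r * x)))%R @[r --> +oo%R])).
  apply: near_eq_cvg; near=> r.
  have r0 : (0 < r)%R by near: r; exact: nbhs_pinfty_gt.
  by rewrite /powR gt_eqF// mulNr mulrC.
apply: (@cvg_comp _ _ _ _ _ _ (@pinfty_nbhs R) _ _ (@cvgr_expR R)).
apply: gt0_cvgMly; rewrite ?x0//; apply/cvgryPge => A; near=> r.
rewrite -[leLHS]expRK ler_ln ?posrE ?expR_gt0//.
Unshelve. all: by end_near. Qed.

(** The antiderivative is [- x^-1 * r^(- x)]. This integral is the origin of the factor [x] in
    [GammaS]. *)
Lemma integral_powRN x : (0 < x)%R ->
  \int[mu]_(r in pos) (powR (r + 1) (- x - 1))%:E = (x^-1)%:E.
Proof.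
move=> x0.
transitivity (\int[mu]_(r in `]1%R, +oo[) (powR r (- x - 1))%:E).
  rewrite integral_mkcond [RHS]integral_mkcond.
  rewrite -[RHS](@ge0_integral_translation _ 1%R)//.
  - apply: eq_integral => r _; rewrite !patchE !mem_setE !in_itv/= !andbT.
    by rewrite ltrDr.
  - apply/(measurable_restrictT _ (measurable_itv _))/measurable_funTS.
    by measurability.
  - by move=> r; rewrite patchE; case: ifP => // _; rewrite lee_fin powR_ge0.
rewrite integral_itv_obnd_cbnd; last first.
  by apply: measurable_funTS; measurability.
have dF (r : R) : (0 < r)%R ->
    is_derive r (1 : R)%R (fun r => - x^-1 * powR r (- x))%R (powR r (- x - 1)).
  move=> r0; have := @is_deriveZ _ _ _ (fun r => powR r (- x)) (- x^-1)%R _ _ _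
    (is_derive1_powR (- x) r0).
  by move/is_derive_eq; apply; rewrite /GRing.scale/= mulrA mulrNN mulVf ?gt_eqF// mul1r.
rewrite (@ge0_continuous_FTC2y _ (fun r => powR r (- x - 1))
   (fun r => - x^-1 * powR r (- x))%R 1 0)//.
- by rewrite powR1 mulr1 -EFinB sub0r opprK.
- by move=> r _; rewrite powR_ge0.
- have cf (r : R) : (0 < r)%R -> {for r, continuous (fun r => powR r (- x - 1))}.
    move=> r0; apply/differentiable_continuous/derivable1_diffP.
    by apply: derivable_powR; rewrite in_itv/= r0.
  apply/continuous_within_itvcyP; split.
    by move=> r; rewrite in_itv/= andbT => r1; exact/cf/(lt_trans ltr01).
  exact/cvg_at_right_filter/cf.
- rewrite -(mulr0 (- x^-1)%R); apply: cvgMr; exact: cvg_powRN.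
- by move=> r r1; have [] := dF _ (lt_trans ltr01 r1).
- suff cF : {for 1%R, continuous (fun r : R => - x^-1 * powR r (- x))%R}.
    exact: cvg_at_right_filter cF.
  apply/differentiable_continuous/derivable1_diffP.
  by have [] := dF _ ltr01.
- move=> r; rewrite in_itv/= andbT => r1.
  by rewrite derive1E; have [_ ->] := dF _ (lt_trans ltr01 r1).
Qed.

Lemma GammaS x : (0 < x)%R -> Gamma (x + 1) = x%:E * Gamma x.
Proof.
(* Integrate [Gamma (x + 1) (r + 1)^(-x-1) = \int h^x exp(-(r + 1) h) dh] over
   [r > 0]. *)
move=> x0.
have xV : x%:E * (x^-1)%:E = 1 by rewrite -EFinM divff ?gt_eqF.
suff -> : Gamma x = (x^-1)%:E * Gamma (x + 1) by rewrite muleA xV mul1e.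
rewrite -integral_powRN// muleC -ge0_integralZl//; last 3 first.
- by apply: measurable_funTS; measurability.
- by move=> r _; rewrite lee_fin powR_ge0.
- exact/ltW/Gamma_gt0.
transitivity (\int[mu]_(r in pos) \int[mu]_(h in pos)
    (powR h (x + 1 - 1) * expR (- ((r + 1) * h)))%:E); last first.
  apply: eq_integral => r /[!inE] /posP r0.
  rewrite Gamma_scaling ?addr_gt0// muleC; congr (_ * (powR _ _)%:E); ring.
rewrite ge0_integral_swap//.
- apply: eq_integral => h /[!inE] /posP h0.
  transitivity ((powR h x * expR (- h))%:E *
      \int[mu]_(r in pos) (powR r (1 - 1) * expR (- (h * r)))%:E).
    rewrite Gamma_scaling// Gamma1 mule1 -EFinM; congr EFin.
    rewrite mulrAC -powRD; last by rewrite (gt_eqF h0) implybT.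
    by [].
  rewrite -ge0_integralZl//.
  + apply: eq_integral => r _; rewrite -EFinM; congr EFin.
    rewrite subrr powRr0 mul1r -mulrA -expRD addrK; congr (_ * expR _)%R; ring.
  + by apply: measurable_funTS; measurability.
  + by move=> r _; rewrite lee_fin mulr_ge0 ?powR_ge0 ?expR_ge0.
  + by rewrite lee_fin mulr_ge0 ?powR_ge0 ?expR_ge0.
- by measurability.
- by move=> r h; rewrite lee_fin mulr_ge0 ?powR_ge0 ?expR_ge0.
Qed.

(** The functional equation settles the positive integers. For [x >= 1] the bound
    [h^(x-1) <= 1 + h^N], with an integer [N > x], compares with [Gamma 1 + Gamma (N + 1)]. For
    [x < 1] the functional equation is used downwards from [x + 1]. *)
Lemma Gamma_lty x : (0 < x)%R -> Gamma x < +oo.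
Proof.
have GN (n : nat) : Gamma n.+1%:R < +oo.
  elim: n => [|n IH]; first by rewrite Gamma1 ltry.
  by rewrite -(addn1 n.+1) natrD GammaS// lte_mul_pinfty.
have G1 y : (1 <= y)%R -> Gamma y < +oo.
  move=> y1; pose N := (Num.truncn y).+1.
  have yN : (y < N%:R)%R by exact: truncnS_gt.
  apply: (@le_lt_trans _ _ (Gamma 1 + Gamma N.+1%:R)); last first.
    by rewrite lte_add_pinfty// Gamma1 ltry.
  rewrite /Gamma -ge0_integralD//; first last.
  - by apply: measurable_funTS; measurability.
  - by move=> h _; rewrite lee_fin mulr_ge0 ?powR_ge0 ?expR_ge0.
  - by apply: measurable_funTS; measurability.
  - by move=> h _; rewrite lee_fin mulr_ge0 ?powR_ge0 ?expR_ge0.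
  apply: ge0_le_integral => //.
  - by move=> h _; rewrite lee_fin mulr_ge0 ?powR_ge0 ?expR_ge0.
  - by apply: measurable_funTS; measurability.
  - by apply: measurable_funTS; measurability.
  - move=> h /posP h0; rewrite -EFinD lee_fin -mulrDl ler_wpM2r ?expR_ge0//.
    rewrite subrr powRr0; have [h1|h1] := leP h 1%R.
      rewrite -[leLHS]addr0 lerD ?powR_ge0//.
      suff : (powR h (y - 1) <= powR h 0)%R by rewrite powRr0.
      by apply: ger_powR; rewrite ?h0// subr_ge0.
    rewrite -[leLHS]add0r lerD ?ler01//; apply: ler_powR; first exact: ltW.
    by rewrite lerD2r (le_trans (ltW yN))// ler_nat.
move=> x0; have [x1|x1] := leP 1%R x; first exact: G1.
have : Gamma (x + 1) < +oo by apply: G1; lra.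
rewrite GammaS//; have := Gamma_gt0 x; case: (Gamma x) => [r|//|//] _.
  by move=> _; rewrite ltry.
by rewrite gt0_muley ?lte_fin.
Qed.

Lemma Gamma_fin_num x : (0 < x)%R -> Gamma x \is a fin_num.
Proof. by move=> x0; rewrite ge0_fin_numE ?Gamma_lty// ltW// Gamma_gt0. Qed.

(** Integrating [r^(b-1) h^(b+c-1) exp(-(r+1) h)] in both orders shows that [Gamma (b + c)] times
    this integral is [Gamma b * Gamma c], which is finite. *)
Lemma integral_beta_prime b c : (0 < b)%R -> (0 < c)%R ->
  \int[mu]_(r in pos) (powR r (b - 1) * powR (r + 1) (- (b + c)))%:E < +oo.
Proof.
move=> b0 c0; set I := (X in X < _).
suff IE : Gamma (b + c) * I = Gamma b * Gamma c.
  have : Gamma (b + c) * I < +oo.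
    by rewrite IE -(fineK (Gamma_fin_num b0)) -(fineK (Gamma_fin_num c0)) ltry.
  have I0 : 0 <= I.
    by apply: integral_ge0 => r _; rewrite lee_fin mulr_ge0 ?powR_ge0.
  clear IE; move: I0; case: I => [r _ _|_|//]; first by rewrite ltry.
  by rewrite gt0_muley// Gamma_gt0.
rewrite -ge0_integralZl//; last 3 first.
- by apply: measurable_funTS; measurability.
- by move=> r _; rewrite lee_fin mulr_ge0 ?powR_ge0.
- exact/ltW/Gamma_gt0.
transitivity (\int[mu]_(r in pos) \int[mu]_(h in pos)
    (powR r (b - 1) * (powR h (b + c - 1) * expR (- ((r + 1) * h))))%:E).
  apply: eq_integral => r /[!inE] /posP r0.
  under eq_integral do rewrite EFinM.
  rewrite ge0_integralZl//.
  + rewrite Gamma_scaling ?addr_gt0// EFinM [LHS]muleC -!muleA.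
    by [].
  + by apply: measurable_funTS; measurability.
  + by move=> h _; rewrite lee_fin mulr_ge0 ?powR_ge0 ?expR_ge0.
  + by rewrite lee_fin powR_ge0.
rewrite ge0_integral_swap//.
- rewrite [X in _ = _ * X]/Gamma -ge0_integralZl//.
  + apply: eq_integral => h /[!inE] /posP h0.
    transitivity ((powR h (b + c - 1) * expR (- h))%:E *
       \int[mu]_(r in pos) (powR r (b - 1) * expR (- (h * r)))%:E).
      rewrite -ge0_integralZl.
      * apply: eq_integral => r _; rewrite -EFinM; congr EFin.
        rewrite mulrDl mul1r opprD expRD [(r * h)%R]mulrC; ring.
      * exact: measurable_itv.
      * by apply: measurable_funTS; measurability.
      * by move=> r _; rewrite lee_fin mulr_ge0 ?powR_ge0 ?expR_ge0.
      * by rewrite lee_fin mulr_ge0 ?powR_ge0 ?expR_ge0.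
    rewrite Gamma_scaling// muleA -EFinM muleC; congr (_ * _%:E).
    rewrite mulrAC -powRD; last by rewrite (gt_eqF h0) implybT.
    by congr (powR _ _ * _)%R; ring.
  + by apply: measurable_funTS; measurability.
  + by move=> h _; rewrite lee_fin mulr_ge0 ?powR_ge0 ?expR_ge0.
  + exact/ltW/Gamma_gt0.
- by measurability.
- by move=> r h; rewrite lee_fin !mulr_ge0 ?powR_ge0 ?expR_ge0.
Qed.

End OneDimensional.

(** * The projective substitution and hypergeometric integrals *)

Section BetaIntegrals.
Variable R : realType.
Local Notation mu := (@lebesgue_measure R).
Local Notation pos := (`]0%R, +oo[ : set R).
Local Open Scope ereal_scope.

Lemma Gamma2 : Gamma (2%R : R) = 1.
Proof. by rewrite -[2%R]/(1 + 1)%R GammaS// Gamma1 mule1. Qed.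

(* Writing [(r + 1)^-2] as the integral of [y exp(-(r + 1) y)] turns the
   substitution into scalings and translations. *)
Lemma ge0_integral_projective (F : R -> \bar R) :
  measurable_fun setT F -> (forall s, 0 <= F s) ->
  \int[mu]_(r in pos) (F (r * powR (r + 1) (- 1))%R * (powR (r + 1) (- 2))%:E) =
  \int[mu]_(s in `]0%R, 1%R[) F s.
Proof.
move=> mF F0; pose G := F \_ (`]0%R, 1%R[).
have mG : measurable_fun [set: R] G.
  exact/(measurable_restrictT _ (measurable_itv _))/measurable_funTS.
have G0 s : 0 <= G s by rewrite /G patchE; case: ifP.
have Gout s : (1 <= s)%R -> G s = 0.
  by move=> s1; rewrite /G patchE mem_setE in_itv/= (le_gtF s1) andbF.
have mGE d (T : measurableType d) (u v : T -> R) : measurable_fun setT u ->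
    measurable_fun setT v -> measurable_fun setT (fun t => G (u t) * (v t)%:E).
  move=> mu mv; apply: emeasurable_funM; first exact: (measurableT_comp mG).
  by measurability.
transitivity (\int[mu]_(r in pos) \int[mu]_(y in pos)
    (G (r * powR (r + 1) (- 1))%R * (powR y (2 - 1) * expR (- ((r + 1) * y)))%:E)).
  apply: eq_integral => r /[!inE] /posP r0.
  have r1 : (0 < r + 1)%R by rewrite addr_gt0.
  rewrite ge0_integralZl//; last 2 first.
  - by apply: measurable_funTS; measurability.
  - by move=> y _; rewrite lee_fin mulr_ge0 ?expR_ge0 ?powR_ge0.
  congr (_ * _).
    rewrite /G patchE ifT// mem_setE in_itv/= powR_inv1 ?(ltW r1)//.
    by apply/andP; split; [exact: divr_gt0 | rewrite ltr_pdivrMr// mul1r ltrDl].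
  by rewrite Gamma_scaling// Gamma2 mule1.
rewrite ge0_integral_swap//; last 2 first.
- by apply: mGE; measurability.
- by move=> r y; rewrite mule_ge0// lee_fin mulr_ge0 ?expR_ge0 ?powR_ge0.
(* The scaling [x = y r] turns [r / (r + 1)] into [x / (x + y)]. *)
transitivity (\int[mu]_(y in pos) \int[mu]_(x in pos)
    (G (x * powR (x + y) (- 1))%R * (expR (- (x + y)))%:E)).
  apply: eq_integral => y /[!inE] /posP y0.
  rewrite [RHS](ge0_integral_scaling_pos y0).
  - rewrite -ge0_integralZl//.
    + apply: eq_integral => r /[!inE] /posP r0.
      have r1 : (0 < r + 1)%R by rewrite addr_gt0.
      have yr1 : (0 < y * r + y)%R by rewrite addr_gt0// mulr_gt0.
      rewrite (_ : (2 - 1 = 1 :> R)%R) ?powRr1 ?(ltW y0)//; last ring.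
      rewrite muleCA -EFinM; congr (G _ * (y * expR _)%:E).
        rewrite !powR_inv1 ?ltW//; field.
        by rewrite !gt_eqF.
      by ring.
    + by apply: measurable_funTS; apply: mGE; measurability.
    + by move=> r _; rewrite mule_ge0// lee_fin expR_ge0.
    + by rewrite lee_fin ltW.
  - by apply: mGE; measurability.
  - by move=> r; rewrite mule_ge0// lee_fin expR_ge0.
rewrite ge0_integral_swap//; last 2 first.
- by apply: mGE; measurability.
- by move=> y x; rewrite mule_ge0// lee_fin expR_ge0.
(* Translating to [z = x + y] gives the range [z > x]. Extending it to [z > 0] adds nothing, since
   [G] vanishes at [x / z >= 1]. *)
transitivity (\int[mu]_(x in pos) \int[mu]_(z in pos)
    (G (x * powR z (- 1))%R * (expR (- z))%:E)).
  apply: eq_integral => x /[!inE] /posP x0.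
  rewrite integral_mkcond [RHS]integral_mkcond.
  rewrite -[RHS](@ge0_integral_translation _ x).
  - apply: eq_integral => y _; rewrite !patchE !mem_setE !in_itv/= !andbT.
    have [y0|y0] := ltP 0%R y.
      by rewrite (addr_gt0 y0 x0) [(y + x)%R]addrC.
    case: ifPn => // yx; rewrite Gout ?mul0e//.
    by rewrite powR_inv1 ?(ltW yx)// ler_pdivlMr// mul1r gerDr.
  - apply/(measurable_restrictT _ (measurable_itv _))/measurable_funTS.
    by apply: mGE; measurability.
  - by move=> y; rewrite patchE; case: ifP => // _; rewrite mule_ge0// lee_fin expR_ge0.
rewrite ge0_integral_swap//; last 2 first.
- by apply: mGE; measurability.
- by move=> y x; rewrite mule_ge0// lee_fin expR_ge0.
have -> : \int[mu]_(s in `]0%R, 1%R[) F s = \int[mu]_(s in pos) G s.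
  rewrite integral_mkcond [RHS]integral_mkcond; apply: eq_integral => s _.
  rewrite /G !patchE !mem_setE !in_itv/= andbT.
  by case: (ltP 0%R s).
(* The last scaling [x = z s] leaves the weight [z exp(-z)], whose integral is [Gamma 2 = 1]. *)
rewrite -[RHS]mul1e -Gamma2 -ge0_integralZr//; first last.
- by apply: integral_ge0.
- by move=> z _; rewrite lee_fin mulr_ge0 ?powR_ge0 ?expR_ge0.
- by apply: measurable_funTS; measurability.
apply: eq_integral => z /[!inE] /posP z0.
rewrite [LHS](ge0_integral_scaling_pos z0).
- rewrite -!ge0_integralZl//.
  + apply: eq_integral => s _.
    rewrite muleCA -EFinM [RHS]muleC; congr (G _ * (_ * expR _)%:E).
      rewrite powR_inv1 ?ltW//; field.
      by rewrite gt_eqF.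
    by rewrite (_ : (2 - 1 = 1 :> R)%R) ?powRr1 ?(ltW z0)//; ring.
  + exact: measurable_funTS.
  + by rewrite lee_fin mulr_ge0 ?powR_ge0 ?expR_ge0.
  + by apply: measurable_funTS; apply: mGE; measurability.
  + by move=> r _; rewrite mule_ge0// lee_fin expR_ge0.
  + by rewrite lee_fin ltW.
- by apply: mGE; measurability.
- by move=> r; rewrite mule_ge0// lee_fin expR_ge0.
Qed.


Section Hypergeometric.
Variables (b c M S Z : R).
Hypotheses (b0 : (0 < b)%R) (c0 : (0 < c)%R).
Hypotheses (S0 : (0 < S)%R) (Z0 : (0 <= Z)%R).
(** In the application [S] is [RSS] and [Z] is [|X bhat|^2], so [r2] is [R^2] and [rho] is
    [1 - R^2]. *)
Let rho := (S / (S + Z))%R.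
Let r2 := (Z / (S + Z))%R.

(** Euler's integral: for positive [b] and [c] and [0 <= r2 < 1] it is the Beta function at [(b, c)]
    times the Gauss hypergeometric function [2F1(-e, b; b + c; r2)]. *)
Definition hyp_integral (b c e r2 : R) : \bar R :=
  \int[mu]_(s in `]0%R, 1%R[)
    (powR s (b - 1) * powR (1 - s) (c - 1) * powR (1 - r2 * s) e)%:E.

Let SZ0 : (0 < S + Z)%R. Proof. by rewrite ltr_wpDr. Qed.
Let rho0 : (0 < rho)%R. Proof. by rewrite divr_gt0. Qed.
Let rho1 : (rho <= 1)%R. Proof. by rewrite ler_pdivrMr// mul1r lerDl. Qed.
Let rhoE : (rho = 1 - r2)%R.
Proof. by rewrite /rho /r2; field; rewrite gt_eqF. Qed.

Let W (r : R) : (0 < r -> 0 < 1 + rho * r)%R.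
Proof. by move=> r0; rewrite addr_gt0// mulr_gt0. Qed.

(** With [s = r / (r + 1)] one has [1 - s = 1 / (r + 1)] and [1 - r2 s = (1 + rho r) / (r + 1)].
    Together with the Jacobian [(r + 1)^(-2)], the powers of [r + 1] add up to [- M]. *)
Lemma hyp_integral_halfline :
  \int[mu]_(r in pos) (powR r (b - 1) * powR (1 + rho * r) (M - (b + c)) *
    powR (r + 1) (- M))%:E = hyp_integral b c (M - (b + c)) r2.
Proof.
rewrite /hyp_integral -ge0_integral_projective; last 2 first.
- by measurability.
- by move=> s; rewrite lee_fin !mulr_ge0 ?powR_ge0.
apply: eq_integral => r /[!inE] /posP r0.
have r1 : (0 < r + 1)%R by rewrite addr_gt0.
have w0 := W r0.
rewrite -EFinM; congr EFin.
have r1V : (0 <= powR (r + 1) (- 1))%R by rewrite powR_ge0.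
have -> : (1 - r * powR (r + 1) (- 1) = powR (r + 1) (- 1))%R.
  by rewrite powR_inv1 ?ltW//; field; rewrite gt_eqF.
have -> : (1 - r2 * (r * powR (r + 1) (- 1)) =
    (1 + rho * r) * powR (r + 1) (- 1))%R.
  by rewrite powR_inv1 ?ltW// rhoE; field; rewrite gt_eqF.
rewrite !powRM ?powR_ge0 ?(ltW r0) ?(ltW w0)// -!powRrM.
set A := powR r _; set B := powR (1 + rho * r) _.
rewrite [RHS](_ : _ = A * B * (powR (r + 1) (- 1 * (b - 1)) *
  powR (r + 1) (- 1 * (c - 1)) * powR (r + 1) (- 1 * (M - (b + c))) *
  powR (r + 1) (- 2)))%R; last by ring.
rewrite -!powRD ?(gt_eqF r1) ?implybT//.
by congr (_ * powR _ _)%R; ring.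
Qed.

Lemma hyp_integral_gt0 : 0 < hyp_integral b c (M - (b + c)) r2.
Proof.
have m01 : mu (`]0%R, 1%R[ : set R) != 0.
  by rewrite lebesgue_measure_itv/= lte_fin ltr01 -EFinB subr0 eqe oner_eq0.
apply: integral_gt0 => //.
- by apply: measurable_funTS; measurability.
- move=> s; rewrite /= in_itv/= => /andP[s0 s1]; rewrite lte_fin !mulr_gt0 ?powR_gt0//.
    by rewrite subr_gt0.
  rewrite subr_gt0 /r2 mulrAC ltr_pdivrMr// mul1r.
  rewrite (@le_lt_trans _ _ Z)// ?ltrDr//.
  by rewrite -[leRHS]mulr1 ler_wpM2l// ltW.
Qed.

(** The quotient [q = (1 + rho r) / (1 + r)] lies between [rho] and [1], so [q^e <= 1 + rho^e]
    whatever the sign of [e]. What remains is the beta prime integral. *)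
Lemma hyp_integral_lty : hyp_integral b c (M - (b + c)) r2 < +oo.
Proof.
rewrite -hyp_integral_halfline; set e := (M - (b + c))%R.
apply: (@le_lt_trans _ _ ((1 + powR rho e)%:E *
    \int[mu]_(r in pos) (powR r (b - 1) * powR (r + 1) (- (b + c)))%:E)).
  rewrite -ge0_integralZl//.
  - apply: ge0_le_integral => //.
    + by move=> r _; rewrite lee_fin !mulr_ge0 ?powR_ge0.
    + by apply: measurable_funTS; measurability.
    + by apply: measurable_funTS; measurability.
    + move=> r /posP r0; rewrite -EFinM lee_fin.
      have r1 : (0 < r + 1)%R by rewrite addr_gt0.
      have w0 := W r0.
      have -> : powR (r + 1) (- M) = (powR (r + 1) (- (b + c)) * powR (r + 1)^-1 e)%R.
        rewrite -(powR_inv1 (ltW r1)) -powRrM -powRD ?(gt_eqF r1) ?implybT//.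
        by congr powR; rewrite /e; ring.
      rewrite mulrAC [leRHS]mulrC mulrA -[leLHS]mulrA ler_wpM2l//.
        by rewrite mulr_ge0 ?powR_ge0.
      rewrite -powRM ?invr_ge0 ?(ltW r1) ?(ltW w0)//.
      set q := ((r + 1)^-1 * _)%R.
      have q1 : (q <= 1)%R.
        by rewrite /q mulrC ler_pdivrMr// mul1r addrC lerD2r ler_piMl// ltW.
      have q0 : (rho <= q)%R.
        rewrite /q mulrC ler_pdivlMr// mulrDr mulr1 addrC lerD2r//.
      have qp : (0 < q)%R by exact: lt_le_trans q0.
      have [e0|e0] := leP 0%R e.
        rewrite -[leLHS]addr0 lerD ?powR_ge0//.
        suff : (powR q e <= powR q 0)%R by rewrite powRr0.
        by apply: ger_powR; rewrite ?qp.
      have [e' e'0 ->] : exists2 e', (0 < e')%R & e = (- e')%R.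
        by exists (- e)%R; rewrite ?opprK ?oppr_gt0.
      rewrite -[leLHS]add0r lerD ?ler01// !powRN lef_pV2 ?posrE ?powR_gt0//.
      by apply: ge0_ler_powR; rewrite ?nnegrE ?(ltW e'0) ?(ltW rho0) ?(ltW qp).
  - by apply: measurable_funTS; measurability.
  - by move=> r _; rewrite lee_fin !mulr_ge0 ?powR_ge0.
  - by rewrite lee_fin addr_ge0 ?powR_ge0.
by rewrite lte_mul_pinfty ?lee_fin ?addr_ge0 ?powR_ge0// integral_beta_prime.
Qed.

(** After [g = h q] the powers of [h] collect to [h^(M-1)], and the integral over [h] is a Gamma
    integral with rate [S + q Z / (q + 1)]. *)
Lemma double_gamma_integral :
  \int[mu]_(h in pos) \int[mu]_(g in pos)
    (powR h (M + c - 1) * powR g (b - 1) * powR (g + h) (- (b + c)) *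
     expR (- (h * S + g * h * powR (g + h) (- 1) * Z)))%:E =
  Gamma M * ((powR S (- M) * powR rho b)%:E *
    hyp_integral b c (M - (b + c)) r2).
Proof.
transitivity (\int[mu]_(h in pos) \int[mu]_(q in pos)
    (powR q (b - 1) * powR (q + 1) (- (b + c)) *
     (powR h (M - 1) * expR (- ((S + q * powR (q + 1) (- 1) * Z) * h))))%:E).
  apply: eq_integral => h /[!inE] /posP h0.
  rewrite (ge0_integral_scaling_pos h0); last 2 first.
  - by measurability.
  - by move=> g; rewrite lee_fin !mulr_ge0 ?powR_ge0 ?expR_ge0.
  rewrite -ge0_integralZl; last 4 first.
  - exact: measurable_itv.
  - by apply: measurable_funTS; measurability.
  - by move=> g _; rewrite lee_fin !mulr_ge0 ?powR_ge0 ?expR_ge0.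
  - by rewrite lee_fin ltW.
  apply: eq_integral => q /[!inE] /posP q0.
  have q1 : (0 < q + 1)%R by rewrite addr_gt0.
  rewrite -EFinM; congr EFin.
  have -> : (h * q + h = h * (q + 1))%R by ring.
  rewrite !powRM ?(ltW h0) ?(ltW q0) ?(ltW q1)//.
  rewrite (_ : (h * S + _ = (S + q * powR (q + 1) (- 1) * Z) * h)%R); last first.
    by rewrite (powR_inv1 (ltW h0)); field; rewrite gt_eqF.
  set E := expR _; set A := powR q _; set B := powR (q + 1) _.
  rewrite [LHS](_ : _ = A * B * ((h * powR h (M + c - 1) * powR h (b - 1) *
    powR h (- (b + c))) * E))%R; last by ring.
  congr (_ * (_ * _))%R; rewrite -{1}(powRr1 (ltW h0)).
  rewrite -!powRD ?(gt_eqF h0) ?implybT//.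
  by congr powR; ring.
rewrite ge0_integral_swap//; last 2 first.
- by measurability.
- by move=> h q; rewrite lee_fin !mulr_ge0 ?powR_ge0 ?expR_ge0.
transitivity (\int[mu]_(q in pos) (Gamma M * (powR q (b - 1) *
   powR (q + 1) (- (b + c)) * powR (S + q * powR (q + 1) (- 1) * Z) (- M))%:E)).
  apply: eq_integral => q /[!inE] /posP q0.
  under eq_integral do rewrite EFinM.
  rewrite ge0_integralZl//.
  - rewrite Gamma_scaling; last first.
      by rewrite ltr_wpDr// !mulr_ge0 ?powR_ge0 ?(ltW q0).
    by rewrite muleA -EFinM muleC.
  - by apply: measurable_funTS; measurability.
  - by move=> g _; rewrite lee_fin !mulr_ge0 ?powR_ge0 ?expR_ge0.
  - by rewrite lee_fin !mulr_ge0 ?powR_ge0.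
rewrite ge0_integralZl//; last 3 first.
- by apply: measurable_funTS; measurability.
- by move=> g _; rewrite lee_fin !mulr_ge0 ?powR_ge0 ?expR_ge0.
- exact/ltW/Gamma_gt0.
congr (_ * _).
(* The scale [rho] is the one that factors the rate: since [rho (S + Z) = S], at [q = rho r] it
   becomes [S (r + 1) / (1 + rho r)]. *)
rewrite (ge0_integral_scaling_pos rho0); last 2 first.
- by measurability.
- by move=> g; rewrite lee_fin !mulr_ge0 ?powR_ge0 ?expR_ge0.
rewrite -hyp_integral_halfline -!ge0_integralZl.
- apply: eq_integral => r /[!inE] /posP r0.
  have r1 : (0 < r + 1)%R by rewrite addr_gt0.
  have w0 := W r0.
  rewrite -!EFinM; congr EFin.
  have -> : (rho * r + 1 = 1 + rho * r)%R by ring.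
  have -> : (S + rho * r * powR (1 + rho * r) (- 1) * Z =
      S * (r + 1) * powR (1 + rho * r) (- 1))%R.
    rewrite powR_inv1 ?ltW//.
    have : (rho * (S + Z) = S)%R by rewrite /rho; field; rewrite gt_eqF.
    move=> E; apply/eqP; rewrite -subr_eq0.
    rewrite (_ : (_ - _ = r * (rho * (S + Z) - S) / (1 + rho * r))%R).
      by rewrite E subrr mulr0 mul0r.
    by field; rewrite gt_eqF.
  have [rho_ge0 r_ge0 r1_ge0 S_ge0] := And4 (ltW rho0) (ltW r0) (ltW r1) (ltW S0).
  rewrite [powR (rho * r) _]powRM// [powR (S * (r + 1) * _) _]powRM ?mulr_ge0 ?powR_ge0//.
  rewrite [powR (S * (r + 1)) _]powRM//.
  rewrite -powRrM -{1}(powRr1 (ltW rho0)).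
  set A := powR r _; set B := powR (r + 1) _; set C := powR S _.
  rewrite [LHS](_ : _ = C * (powR rho 1 * powR rho (b - 1)) * (A *
    (powR (1 + rho * r) (- (b + c)) * powR (1 + rho * r) (- 1 * - M)) * B))%R; last by ring.
  rewrite -!powRD ?(gt_eqF w0) ?(gt_eqF rho0) ?implybT//.
  by congr (_ * powR _ _ * (_ * powR _ _ * _))%R; ring.
- exact: measurable_itv.
- by apply: measurable_funTS; measurability.
- by move=> g _; rewrite lee_fin !mulr_ge0 ?powR_ge0 ?expR_ge0.
- by rewrite lee_fin mulr_ge0 ?powR_ge0.
- exact: measurable_itv.
- by apply: measurable_funTS; measurability.
- by move=> g _; rewrite lee_fin !mulr_ge0 ?powR_ge0 ?expR_ge0.
- by rewrite lee_fin ltW.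
Qed.

End Hypergeometric.

End BetaIntegrals.

(** * The squared Euclidean norm *)

Section SquaredNorm.
Variable R : realType.
Implicit Types m n p : nat.

Lemma sqnormE m (v : 'cV[R]_m) : sqnorm v = (v^T *m v) 0 0.
Proof. by rewrite mxE; apply: eq_bigr => i _; rewrite mxE expr2. Qed.

Lemma sqnorm_ge0 m (v : 'cV[R]_m) : 0 <= sqnorm v.
Proof. by apply: sumr_ge0 => i _; exact: sqr_ge0. Qed.

Lemma sqnorm_eq0 m (v : 'cV[R]_m) : (sqnorm v == 0) = (v == 0).
Proof.
apply/idP/eqP => [|->]; last first.
  by rewrite /sqnorm big1// => i _; rewrite mxE expr0n.
rewrite psumr_eq0 => [/allP v0|i _]; last exact: sqr_ge0.
apply/matrixP => i j; rewrite ord1 mxE.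
by have /(_ (mem_index_enum _)) := v0 i; rewrite sqrf_eq0 => /eqP.
Qed.

Lemma sqnormN m (v : 'cV[R]_m) : sqnorm (- v) = sqnorm v.
Proof. by apply: eq_bigr => i _; rewrite mxE sqrrN. Qed.

Lemma sqnormZ m (k : R) (v : 'cV[R]_m) : sqnorm (k *: v) = k ^+ 2 * sqnorm v.
Proof. by rewrite /sqnorm big_distrr/=; apply: eq_bigr => i _; rewrite mxE exprMn. Qed.

Lemma sqnormD m (u v : 'cV[R]_m) :
  sqnorm (u + v) = sqnorm u + (u^T *m v) 0 0 *+ 2 + sqnorm v.
Proof.
rewrite /sqnorm mxE -sumrMnl -!big_split/=.
by apply: eq_bigr => i _; rewrite !mxE sqrrD.
Qed.

Lemma sqnorm_orthD m (u v : 'cV[R]_m) :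
  u^T *m v = 0 -> sqnorm (u + v) = sqnorm u + sqnorm v.
Proof. by move=> uv; rewrite sqnormD uv mxE mul0rn addr0. Qed.

Lemma sqnorm_ones n : sqnorm (ones R n) = n%:R.
Proof.
rewrite /sqnorm (eq_bigr (fun=> 1)); last by move=> i _; rewrite mxE expr1n.
by rewrite sumr_const card_ord.
Qed.

Lemma sqnorm_cons m (x : R) (v : 'cV[R]_m) :
  sqnorm (col_mx x%:M v : 'cV[R]_(1 + m)) = x ^+ 2 + sqnorm v.
Proof.
rewrite /sqnorm big_split_ord/= big_ord1 col_mxEu mxE eqxx mulr1n.
by congr (_ + _); apply: eq_bigr => i _; rewrite col_mxEd.
Qed.

Lemma sqnorm_mulmx_le m n (B : 'M[R]_(m, n)) :
  exists2 K, 0 < K & forall v, sqnorm (B *m v) <= K * sqnorm v.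
Proof.
(* The entries of [v] are bounded by its norm, which gives the sum of squared row sums. The summand
   [1] keeps the constant positive, so that it can be inverted later. *)
exists (1 + \sum_i (\sum_j `|B i j|) ^+ 2).
  by rewrite ltr_pwDl// sumr_ge0// => i _; exact: sqr_ge0.
move=> v; rewrite mulrDl mul1r ler_wpDl ?sqnorm_ge0//.
rewrite {1}/sqnorm big_distrl/=; apply: ler_sum => i _.
have vj j : `|v j 0| <= Num.sqrt (sqnorm v).
  rewrite -sqrtr_sqr ler_wsqrtr// /sqnorm (bigD1 j)//= lerDl sumr_ge0// => k _.
  exact: sqr_ge0.
rewrite -[leRHS](_ : ((\sum_j `|B i j|) * Num.sqrt (sqnorm v)) ^+ 2 = _); last first.
  by rewrite exprMn sqr_sqrtr ?sqnorm_ge0.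
rewrite -real_normK ?num_real// lerXn2r ?nnegrE ?normr_ge0//.
  by rewrite mulr_ge0 ?sqrtr_ge0// sumr_ge0.
rewrite mxE (le_trans (ler_norm_sum _ _ _))// big_distrl/=.
by apply: ler_sum => j _; rewrite normrM ler_wpM2l.
Qed.

End SquaredNorm.

(** * Least squares and the decomposition of the residual *)

Section LeastSquares.
Variables (R : realType) (n p : nat) (X : 'M[R]_(n, p)) (y : 'cV[R]_n).
Hypotheses (n0 : (0 < n)%N) (X1 : (ones R n)^T *m X = 0) (rX : \rank X = p).

(** If [u X'X = 0] then [|X u'|^2 = u X'X u' = 0], and full column rank gives [u = 0]. *)
Lemma gram_unitmx : X^T *m X \in unitmx.
Proof.
rewrite -row_free_unit -kermx_eq0; apply/eqP/row_matrixP => i.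
set u := row i _; rewrite row0.
have uXX : u *m (X^T *m X) = 0.
  by apply: (sub_kermxP _); rewrite row_sub.
have : sqnorm (X *m u^T) == 0.
  rewrite sqnormE trmx_mul trmxK mulmxA -(mulmxA u) uXX mul0mx mxE//.
rewrite sqnorm_eq0 => /eqP Xu.
have rf : row_free X^T by rewrite /row_free mxrank_tr rX.
by apply: (row_free_inj rf); rewrite mul0mx -[LHS]trmxK trmx_mul trmxK Xu trmx0.
Qed.

Lemma mulmx_inj_col (v : 'cV[R]_p) : X *m v = 0 -> v = 0.
Proof.
move=> Xv; rewrite -[v]mul1mx -(mulVmx gram_unitmx) -!mulmxA Xv.
by rewrite !mulmx0.
Qed.

Lemma sqnorm_mulmx_gt0 (v : 'cV[R]_p) : v != 0 -> 0 < sqnorm (X *m v).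
Proof.
move=> v0; rewrite lt0r sqnorm_ge0 andbT sqnorm_eq0.
by apply: contra v0 => /eqP/mulmx_inj_col ->.
Qed.

(** The left inverse [(X'X)^-1 X'] of [X] is bounded. The lower bound serves to dominate
    [exp(-|X b|^2)] by an isotropic Gaussian. *)
Lemma sqnorm_mulmx_ge : exists2 k, 0 < k & forall v, k * sqnorm v <= sqnorm (X *m v).
Proof.
have [K K0 KP] := sqnorm_mulmx_le (invmx (X^T *m X) *m X^T).
exists K^-1; first by rewrite invr_gt0.
move=> v; rewrite ler_pdivrMl//; apply: le_trans (KP _).
by rewrite mulmxA -(mulmxA (invmx _)) mulVmx ?gram_unitmx// mul1mx.
Qed.

(** The vector [bhat] of the overview. *)
Definition lse : 'cV[R]_p := invmx (X^T *m X) *m X^T *m ycent y.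

Lemma mulmx_lse : X *m lse = hatmx X *m ycent y.
Proof. by rewrite /lse /hatmx !mulmxA. Qed.

Lemma residual_orth : ((1%:M - hatmx X) *m ycent y)^T *m X = 0.
Proof.
apply: trmx_inj; rewrite trmx_mul trmxK trmx0 mulmxA [X^T *m (_ - _)]mulmxBr mulmx1 /hatmx.
by rewrite !mulmxA mulmxV ?gram_unitmx// mul1mx subrr mul0mx.
Qed.

Lemma ycent_orth : (ones R n)^T *m ycent y = 0.
Proof.
apply/matrixP => i j; rewrite !ord1 !mxE.
under eq_bigr do rewrite !mxE mul1r mulr1.
rewrite sumrB sumr_const card_ord -mulr_natr /ybar -mulrA mulVf ?mulr1 ?subrr//.
by rewrite pnatr_eq0 -lt0n.
Qed.

Lemma sqnorm_ycent : sqnorm (ycent y) = RSS X y + sqnorm (X *m lse).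
Proof.
rewrite /RSS -sqnorm_orthD; last by rewrite mulmxA residual_orth mul0mx.
by rewrite mulmx_lse -mulmxDl subrK mul1mx.
Qed.

(** The vector splits into a multiple of [ones], the residual of [ycent y], and an element of the
    column span of [X]. These are mutually orthogonal by the centering of [X] and the normal
    equations. *)
Lemma sqnorm_residual (alpha : R) (beta : 'cV[R]_p) :
  sqnorm (y - alpha *: ones R n - X *m beta) =
  n%:R * (alpha - ybar y) ^+ 2 + RSS X y + sqnorm (X *m (beta - lse)).
Proof.
have -> : y - alpha *: ones R n - X *m beta =
    (ybar y - alpha) *: ones R n +
    ((1%:M - hatmx X) *m ycent y + X *m (lse - beta)).
  rewrite [X *m (lse - beta)]mulmxBr mulmx_lse mulmxBl mul1mx scalerBl /ycent.
  by apply/matrixP => i j; rewrite !mxE; ring.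
rewrite sqnorm_orthD; last first.
  rewrite linearZ/= -scalemxAl mulmxDr [(ones R n)^T *m (X *m _)]mulmxA X1 mul0mx addr0.
  rewrite mulmxBl mul1mx (mulmxBr (ones R n)^T (ycent y)) ycent_orth sub0r /hatmx !mulmxA X1 !mul0mx.
  by rewrite oppr0 scaler0.
rewrite sqnorm_orthD; last by rewrite mulmxA residual_orth mul0mx.
rewrite sqnormZ sqnorm_ones -/(RSS X y) -(opprB beta lse) mulmxN sqnormN.
ring.
Qed.

End LeastSquares.

(** * Measurability of norms and finiteness of Gaussian integrals *)

Section GaussianIntegrals.
Variable R : realType.
Local Notation mu := (@lebesgue_measure R).
Implicit Types m n p : nat.

Lemma measurable_sqnorm_affine d (T : measurableType d) m n (B : 'M[R]_(n, m))
    (w : T -> 'cV[R]_n) :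
  (forall i, measurable_fun setT (fun t => w t i 0)) ->
  measurable_fun setT (fun z : T * m.-tuple R => sqnorm (w z.1 + B *m colt z.2)).
Proof.
move=> mw; rewrite /sqnorm; apply: measurable_sum => i.
apply: (@measurable_funX _ _ _ setT (fun z => (w z.1 + B *m colt z.2) i 0)).
apply: (eq_measurable_fun (fun z : T * m.-tuple R =>
  w z.1 i 0 + \sum_j B i j * tnth z.2 j)).
  by move=> z _; rewrite !mxE; congr (_ + _); apply: eq_bigr => j _; rewrite mxE.
apply: measurable_funD; first exact: (measurableT_comp (mw i)).
apply: measurable_sum => j; apply: measurable_funM => //.
by apply: (measurableT_comp (measurable_tnth j)).
Qed.

Lemma measurable_sqnorm_mulmx d (T : measurableType d) m n (B : 'M[R]_(n, m)) :
  measurable_fun setT (fun z : T * m.-tuple R => sqnorm (B *m colt z.2)).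
Proof.
have := @measurable_sqnorm_affine d T m n B (fun=> 0) _.
under eq_fun do rewrite add0r.
by apply => i; exact: measurable_cst.
Qed.

Lemma measurable_sqnorm_mulmx0 m n (B : 'M[R]_(n, m)) :
  measurable_fun setT (fun s : m.-tuple R => sqnorm (B *m colt s)).
Proof.
have mg : measurable_fun setT (fun s : m.-tuple R => (tt, s)).
  exact: measurable_fun_pair.
exact: (measurableT_comp (measurable_sqnorm_mulmx B) mg).
Qed.

Lemma measurable_sqnorm0 m : measurable_fun setT (fun s : m.-tuple R => sqnorm (colt s)).
Proof.
by have := measurable_sqnorm_mulmx0 (1%:M : 'M[R]_m); under eq_fun do rewrite mul1mx.
Qed.

Lemma measurable_sqnorm d (T : measurableType d) m :
  measurable_fun setT (fun z : T * m.-tuple R => sqnorm (colt z.2)).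
Proof.
by have := @measurable_sqnorm_mulmx _ T _ _ (1%:M : 'M[R]_m); under eq_fun do rewrite mul1mx.
Qed.

Local Open Scope ereal_scope.

Lemma intRn_gt0 m (F : 'cV[R]_m -> \bar R) :
  col_measurable0 F -> (forall v, 0 < F v) -> 0 < intRn F.
Proof.
elim: m F => [|m IH] F mF F0 /=; first exact: F0.
have mT : mu [set: R] != 0 by rewrite -set_itvNyy lebesgue_measure_itv.
apply: integral_gt0 => //.
  by apply: measurable_intRn_cons => // v; exact: ltW.
move=> x _; apply: IH => //.
exact: (col_measurable_section _ (col_measurable0_cons mF)).
Qed.

Lemma integral_gauss_scaled (c : R) : (0 < c)%R ->
  \int[mu]_x (expR (- (c * x ^+ 2)))%:E < +oo.
Proof.
move=> c0; have sc0 : (0 < Num.sqrt c)%R by rewrite sqrtr_gt0.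
set I := (X in X < _).
have : \int[mu]_x (expR (- x ^+ 2))%:E < +oo.
  have /integrableP[_] := @integrableT_gauss R; apply: le_lt_trans.
  rewrite le_eqVlt; apply/orP; left; apply/eqP; apply: eq_integral => x _.
  by rewrite /= ger0_norm ?expR_ge0.
rewrite (ge0_integral_scaling sc0).
- rewrite [X in _ * X](_ : _ = I); last first.
    by apply: eq_integral => x _; rewrite exprMn sqr_sqrtr ?(ltW c0).
  have : 0 <= I by apply: integral_ge0 => x _; rewrite lee_fin expR_ge0.
  by case: I => [r _ _|_|//]; rewrite ?ltry// gt0_muley ?lte_fin.
- by under eq_fun do rewrite expr2; measurability.
- by move=> x; rewrite lee_fin expR_ge0.
Qed.

Lemma intRn_gauss_lty m (c : R) : (0 < c)%R ->
  intRn (fun v : 'cV[R]_m => (expR (- (c * sqnorm v)))%:E) < +oo.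
Proof.
move=> c0; elim: m => [|m IH] /=; first by rewrite ltry.
have G0 (v : 'cV[R]_m) : 0 <= (expR (- (c * sqnorm v)))%:E by rewrite lee_fin expR_ge0.
have mG : col_measurable0 (fun v : 'cV[R]_m => (expR (- (c * sqnorm v)))%:E).
  by have ? := @measurable_sqnorm0 m; rewrite /col_measurable0; measurability.
under eq_integral => x _.
  rewrite (_ : intRn _ = (expR (- (c * x ^+ 2)))%:E *
      intRn (fun v : 'cV[R]_m => (expR (- (c * sqnorm v)))%:E)); last first.
    rewrite -intRnZl ?lee_fin ?expR_ge0//.
    apply: eq_intRn => v; rewrite (sqnorm_cons x v) -EFinM -expRD.
    by congr (expR _)%:E; ring.
  over.
have I0 := intRn_ge0 G0; move: IH I0; set I := intRn _ => Iy I0.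
rewrite ge0_integralZr//.
- have := integral_gauss_scaled c0.
  set J := \int[_]_x _ => Jy.
  have J0 : 0 <= J by apply: integral_ge0 => x _; rewrite lee_fin expR_ge0.
  by apply: lte_mul_pinfty => //; rewrite ge0_fin_numE.
- by under eq_fun do rewrite expr2; measurability.
Qed.

End GaussianIntegrals.

(** * Scale dependence of Gaussian integrals *)

Section GaussianFactors.
Variable R : realType.
Local Notation mu := (@lebesgue_measure R).
Local Open Scope ereal_scope.

Lemma integral_gauss_centered (nu h m : R) : (0 < h)%R ->
  \int[mu]_x (expR (- (h * (nu * (x - m) ^+ 2))))%:E =
  (powR h (- 2^-1))%:E * \int[mu]_x (expR (- (nu * x ^+ 2)))%:E.
Proof.
move=> h0; have c0 : (0 < powR h (- 2^-1))%R by rewrite powR_gt0.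
have mE : measurable_fun setT (fun x : R => (expR (- (h * (nu * x ^+ 2))))%:E).
  by under eq_fun do rewrite expr2; measurability.
rewrite (ge0_integral_translation (- m) mE); last first.
  by move=> x; rewrite lee_fin expR_ge0.
rewrite (ge0_integral_scaling c0 mE); last first.
  by move=> x; rewrite lee_fin expR_ge0.
congr (_ * _); apply: eq_integral => x _; congr (expR (- _))%:E.
rewrite exprMn -(@powR_mulrn _ (powR _ _) 2) ?powR_ge0// -powRrM mulNr mulVf ?pnatr_eq0//.
by rewrite (powR_inv1 (ltW h0)); field; rewrite gt_eqF.
Qed.

Lemma complete_square n (u v : 'cV[R]_n) (g h : R) : (0 < g)%R -> (0 < h)%R ->
  (h * sqnorm (u - v) + g * sqnorm u =
   (g + h) * sqnorm (u - (h / (g + h)) *: v) +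
   g * h * powR (g + h) (- 1) * sqnorm v)%R.
Proof.
move=> g0 h0; have gh0 : (0 < g + h)%R by rewrite addr_gt0.
rewrite (powR_inv1 (ltW gh0)) !sqnormD !sqnormN sqnormZ !linearN/= -scalemxAr.
by rewrite !mxE !mulr2n; field; rewrite gt_eqF.
Qed.

(** Completing the square, a translation to the minimiser, and a scaling by [(g + h)^(-1/2)] in each
    of the [p] coordinates. The determinant of [X'X] stays hidden in the last factor, which does not
    depend on [g], [h] or [w]. *)
Lemma intRn_gauss_product n p (X : 'M[R]_(n, p)) (w : 'cV[R]_p) (g h : R) :
  (0 < g)%R -> (0 < h)%R ->
  intRn (fun b : 'cV[R]_p =>
    (expR (- (h * sqnorm (X *m (b - w)) + g * sqnorm (X *m b))))%:E) =
  (powR (g + h) (- (p%:R / 2)) *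
    expR (- (g * h * powR (g + h) (- 1) * sqnorm (X *m w))))%:E *
  intRn (fun b : 'cV[R]_p => (expR (- sqnorm (X *m b)))%:E).
Proof.
move=> g0 h0; have gh0 : (0 < g + h)%R by rewrite addr_gt0.
set q := (g * h * _ * _)%R.
have mX := @measurable_sqnorm_mulmx0 R p n X.
have mG (k : R) : col_measurable0 (fun b : 'cV[R]_p =>
    (expR (- (k * sqnorm (X *m b))))%:E).
  by rewrite /col_measurable0; measurability.
have G0 (k : R) (b : 'cV[R]_p) : 0 <= (expR (- (k * sqnorm (X *m b))))%:E.
  by rewrite lee_fin expR_ge0.
transitivity ((expR (- q))%:E * intRn (fun b : 'cV[R]_p =>
    (expR (- ((g + h) * sqnorm (X *m (b + - ((h / (g + h)) *: w))))))%:E)).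
  rewrite -intRnZl ?lee_fin ?expR_ge0//; last first.
    exact: (col_measurable0_translation _ (mG _)).
  apply: eq_intRn => b; rewrite -EFinM -expRD; congr (expR _)%:E.
  by rewrite !mulmxBr complete_square// -scalemxAr /q opprD addrC.
rewrite (intRn_translation _ (mG _) (G0 _)) EFinM [(powR _ _)%:E * _]muleC -muleA.
congr (_ * _).
have c0 : (0 < powR (g + h) (- 2^-1))%R by rewrite powR_gt0.
rewrite (intRn_scaling c0 (mG _) (G0 _)); congr (_%:E * _).
  by rewrite -(@powR_mulrn _ (powR _ _)) ?powR_ge0// -powRrM mulNr mulrC.
apply: eq_intRn => b; congr (expR (- _))%:E.
rewrite -scalemxAr sqnormZ -(@powR_mulrn _ (powR _ _) 2) ?powR_ge0// -powRrM mulNr.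
rewrite mulVf ?pnatr_eq0// (powR_inv1 (ltW gh0)) mulrA divff ?mul1r//.
by rewrite gt_eqF.
Qed.

End GaussianFactors.

(** * The radial integral of the error density and its moments *)

Section RadialDensity.
Variables (R : realType) (f : R -> R).
Hypotheses (mf : measurable_fun [set: R] f) (f0 : forall t, (0 <= f t)%R).
Local Notation mu := (@lebesgue_measure R).
Local Notation pos := (`]0%R, +oo[ : set R).
Local Open Scope ereal_scope.

(** With [t = 1/v] this is the Mellin transform of [f], the integral of [t^(N-1) f(t)]. The
    overview's [P_k] is the case [N = n/2 + k]. *)
Definition radial_mass (N : R) : \bar R :=
  \int[mu]_(v in pos) (powR v (- N - 1) * f (powR v (- 1)))%:E.

Lemma measurable_fun_radial d (T : measurableType d) (g : T -> R) :
  measurable_fun setT g -> measurable_fun setT (fun t => f (g t)).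
Proof. exact: (measurableT_comp mf). Qed.

Lemma radial_mass_ge0 N : 0 <= radial_mass N.
Proof. by apply: integral_ge0 => v _; rewrite lee_fin mulr_ge0 ?powR_ge0. Qed.

Lemma radial_scaling (N s : R) : (0 < s)%R ->
  \int[mu]_(v in pos) (powR v (- N - 1) * f (s * powR v (- 1)))%:E =
  (powR s (- N))%:E * radial_mass N.
Proof.
move=> s0.
rewrite (ge0_integral_scaling_pos s0); last 2 first.
- by measurability; apply: measurable_fun_radial; measurability.
- by move=> v; rewrite lee_fin mulr_ge0 ?powR_ge0.
have -> : powR s (- N) = (s * powR s (- N - 1))%R.
  rewrite -{2}(powRr1 (ltW s0)) -powRD ?(gt_eqF s0) ?implybT//.
  by congr powR; ring.
rewrite EFinM -muleA; congr (_ * _); rewrite -ge0_integralZl//; last 3 first.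
- by apply: measurable_funTS; measurability; apply: measurable_fun_radial; measurability.
- by move=> v _; rewrite lee_fin mulr_ge0 ?powR_ge0.
- by rewrite lee_fin powR_ge0.
apply: eq_integral => v /[!inE] /posP v0.
rewrite -EFinM mulrA !powRM ?(ltW s0) ?(ltW v0)//; congr (_ * f _)%:E.
by rewrite mulrA (powR_inv1 (ltW s0)) divff ?gt_eqF// mul1r.
Qed.

Lemma radial_mass_moment n k : (0 < n)%N ->
  radial_mass (n%:R / 2 + k%:R) *
    intRn (fun e : 'cV[R]_n => (expR (- sqnorm e))%:E) =
  Gamma (n%:R / 2) *
    intRn (fun e : 'cV[R]_n => (f (sqnorm e) * sqnorm e ^+ k)%:E).
Proof.
(* Integrating [K] over [v], then over [e], gives the left-hand side.  Swapping
   and substituting [e = sqrt v e'] replaces [K] by [H], whose integral over [v],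
   then over [e], is the right-hand side. *)
move=> n0; set N := (_ + k%:R)%R.
have ms0 := @measurable_sqnorm0 R n.
have ms := @measurable_sqnorm R _ (measurableTypeR R) n.
have fs0 := measurable_fun_radial ms0.
pose K (v : R) (e : 'cV[R]_n) := (powR v (- N - 1) * f (sqnorm e * powR v (- 1)) *
  (powR (sqnorm e) N * expR (- sqnorm e)))%:E.
have K0 v e : 0 <= K v e by rewrite lee_fin !mulr_ge0 ?powR_ge0 ?expR_ge0.
have mK : col_measurable (K : measurableTypeR R -> _).
  rewrite /col_measurable /K; measurability.
  by apply: measurable_fun_radial; measurability.
have mK0 v : col_measurable0 (K v) by exact: (col_measurable_section v mK).
pose H (v : R) (e : 'cV[R]_n) := (powR (sqnorm e) N * f (sqnorm e) *
  (powR v (n%:R / 2 - 1) * expR (- (sqnorm e * v))))%:E.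
have H0 v e : 0 <= H v e by rewrite lee_fin !mulr_ge0 ?powR_ge0 ?expR_ge0.
have mH : col_measurable (H : measurableTypeR R -> _).
  rewrite /col_measurable /H; measurability.
  by apply: measurable_fun_radial; measurability.
have mI (L : R -> 'cV[R]_n -> \bar R) :
    col_measurable (L : measurableTypeR R -> _) -> (forall v e, 0 <= L v e) ->
    col_measurable0 (fun e => \int[mu]_(v in pos) L v e).
  move=> mL L0; apply: (@ge0_measurable_integral_r _ _ _ _ _ mu pos
    (fun (s : n.-tuple R) v => L v (colt s))) => //.
  have h : measurable_fun setT
      (fun z : n.-tuple R * measurableTypeR R => (z.2, z.1)).
    exact: measurable_fun_pair.
  exact: (measurableT_comp mL h).
have nE v : (0 < v)%R -> intRn (K v) = intRn (H v).
  move=> v0; have c0 : (0 < powR v (2^-1))%R by rewrite powR_gt0.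
  rewrite (intRn_scaling c0 (mK0 v) (K0 v)) -intRnZl//; last 2 first.
  - by rewrite lee_fin exprn_ge0 ?powR_ge0.
  - exact: col_measurable0_scaling.
  apply: eq_intRn => e; rewrite /K /H -EFinM; congr EFin.
  rewrite sqnormZ -(@powR_mulrn _ (powR _ _) 2) ?powR_ge0// -powRrM mulVf ?pnatr_eq0//.
  rewrite (powRr1 (ltW v0)) -(@powR_mulrn _ (powR _ _)) ?powR_ge0// -powRrM.
  rewrite (_ : v * sqnorm e * powR v (- 1) = sqnorm e)%R; last first.
    by rewrite (powR_inv1 (ltW v0)); field; rewrite gt_eqF.
  rewrite (powRM _ (ltW v0) (sqnorm_ge0 _)).
  rewrite (_ : (2^-1 * n%:R = n%:R / 2)%R) 1?mulrC//.
  rewrite [(v * _)%R]mulrC.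
  set E := expR _; set A := powR (sqnorm e) _.
  rewrite [LHS](_ : _ = A * f (sqnorm e) *
    (powR v (n%:R / 2) * powR v (- N - 1) * powR v N * E))%R; last by ring.
  rewrite -!powRD ?(gt_eqF v0) ?implybT//.
  by congr (_ * (powR _ _ * _))%R; ring.
have s_gt0 (e : 'cV[R]_n) : (e != 0 -> 0 < sqnorm e)%R.
  by move=> e0; rewrite lt0r sqnorm_ge0 sqnorm_eq0 e0.
transitivity (intRn (fun e => \int[mu]_(v in pos) K v e)).
  rewrite -intRnZl ?radial_mass_ge0//; last first.
    by rewrite /col_measurable0; measurability.
  (* At [e = 0] the kernel [K] vanishes through [powR 0 N = 0], whereas the left-hand side is
     [radial_mass f N]. *)
  apply: eq_intRn_off0 => //.
  - apply: measurable_funeM; measurability.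
  - exact: mI.
  - by move=> e; rewrite mule_ge0 ?radial_mass_ge0// lee_fin expR_ge0.
  - by move=> e; exact: integral_ge0.
  move=> e /s_gt0 se0; rewrite /K.
  under eq_integral do rewrite mulrC EFinM.
  rewrite ge0_integralZl//; last 3 first.
  - by apply: measurable_funTS; measurability; apply: measurable_fun_radial; measurability.
  - by move=> v _; rewrite lee_fin mulr_ge0 ?powR_ge0.
  - by rewrite lee_fin mulr_ge0 ?powR_ge0 ?expR_ge0.
  rewrite radial_scaling// muleA muleC -EFinM; congr (_%:E * _).
  by rewrite mulrAC -powRD ?(gt_eqF se0) ?implybT// subrr powRr0 mul1r.
rewrite -(intRn_swap mu _ mK)//.
transitivity (\int[mu]_(v in pos) intRn (H v)).
  by apply: eq_integral => v /[!inE] /posP v0; exact: nE.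
rewrite (intRn_swap mu _ mH)// -intRnZl//; last 3 first.
- exact/ltW/Gamma_gt0.
- by rewrite /col_measurable0; measurability; exact: measurable_funX.
- by move=> e; rewrite lee_fin mulr_ge0// exprn_ge0 ?sqnorm_ge0.
apply: eq_intRn_off0 => //.
- exact: mI.
- apply: measurable_funeM; measurability; exact: measurable_funX.
- by move=> e; exact: integral_ge0.
- move=> e; rewrite mule_ge0 ?(ltW (Gamma_gt0 _))// lee_fin mulr_ge0//.
  by rewrite exprn_ge0 ?sqnorm_ge0.
move=> e /s_gt0 se0; rewrite /H.
under eq_integral do rewrite EFinM.
rewrite ge0_integralZl//; last 3 first.
- by apply: measurable_funTS; measurability.
- by move=> v _; rewrite lee_fin mulr_ge0 ?powR_ge0 ?expR_ge0.
- by rewrite lee_fin mulr_ge0 ?powR_ge0.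
rewrite Gamma_scaling// muleA muleC -EFinM; congr (_ * _%:E).
rewrite mulrAC -powRD ?(gt_eqF se0) ?implybT// mulrC; congr (_ * _)%R.
rewrite -powR_mulrn ?(ltW se0)//; congr powR; rewrite /N; ring.
Qed.

End RadialDensity.

(** * Factorisation and reduction of the posterior integral *)

Section PosteriorIntegral.
Variables (R : realType) (n p : nat) (X : 'M[R]_(n, p)) (y : 'cV[R]_n).
Hypotheses (n0 : (0 < n)%N) (p0 : (0 < p)%N).
Hypotheses (X1 : (ones R n)^T *m X = 0) (rX : \rank X = p).
Hypothesis RSS0 : 0 < RSS X y.
Local Notation mu := (@lebesgue_measure R).
Local Notation pos := (`]0%R, +oo[ : set R).

Let s (alpha : R) (beta : 'cV[R]_p) : R :=
  n%:R * (alpha - ybar y) ^+ 2 + RSS X y + sqnorm (X *m (beta - lse X y)).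

Let s_gt0 alpha beta : 0 < s alpha beta.
Proof.
rewrite /s; apply: ltr_wpDr; first exact: sqnorm_ge0.
by apply: ltr_wpDl => //; rewrite mulr_ge0 ?sqr_ge0.
Qed.

Let measurable_r :
  measurable_fun setT (fun z : measurableTypeR R * p.-tuple R =>
    sqnorm (X *m (colt z.2 - lse X y))).
Proof.
have := @measurable_sqnorm_affine R _ (measurableTypeR R) p n X
  (fun=> - (X *m lse X y)) _.
by under eq_fun do rewrite addrC -mulmxBr; apply => i; exact: measurable_cst.
Qed.

Let measurable_s :
  measurable_fun setT (fun z : measurableTypeR R * p.-tuple R => s z.1 (colt z.2)).
Proof. by rewrite /s; under eq_fun do rewrite expr2; measurability. Qed.

Let measurable_q :
  measurable_fun setT (fun z : measurableTypeR R * p.-tuple R => sqnorm (X *m colt z.2)).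
Proof. exact: measurable_sqnorm_mulmx. Qed.

Local Open Scope ereal_scope.

(** The overview's [Q_k] is the case [N = n/2 + k], [b = (p - a)/2]. *)
Definition quadratic_integral (N b : R) : \bar R :=
  \int[mu]_alpha intRn (fun beta : 'cV[R]_p =>
    (powR (s alpha beta) (- N) * powR (sqnorm (X *m beta)) (- b))%:E).

Let K (N b alpha : R) (beta : 'cV[R]_p) :=
  (powR (s alpha beta) (- N) * powR (sqnorm (X *m beta)) (- b))%:E.

Let K_ge0 N b alpha beta : 0 <= K N b alpha beta.
Proof. by rewrite lee_fin mulr_ge0 ?powR_ge0. Qed.

Let measurable_K N b : col_measurable (K N b : measurableTypeR R -> _).
Proof. by rewrite /col_measurable /K; measurability. Qed.

Lemma post_int_factor (f : R -> R) (a : R) (k : nat) :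
  measurable_fun [set: R] f -> (forall t, (0 <= f t)%R) ->
  post_int X y f a k =
  radial_mass f (n%:R / 2 + k%:R) *
  quadratic_integral (n%:R / 2 + k%:R) ((p%:R - a) / 2).
Proof.
move=> mf f0; set N := (_ + k%:R)%R; set b := (_ / 2)%R.
have P0 := radial_mass_ge0 f0 N.
rewrite /post_int /quadratic_integral -ge0_integralZl//; last 2 first.
- exact: (measurable_intRn (measurable_K N b) (K_ge0 N b)).
- by move=> alpha _; apply: intRn_ge0; exact: (K_ge0 N b).
apply: eq_integral => alpha _.
rewrite -(intRnZl P0 (col_measurable_section alpha (measurable_K N b)) (K_ge0 N b alpha)).
apply: eq_intRn => beta.
rewrite (_ : [set v : R | (0 < v)%R] = pos); last first.
  by apply/seteqP; split => v /=; rewrite in_itv/= andbT.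
rewrite (sqnorm_residual y n0 X1 rX) -/(s alpha beta) /K.
set S := s alpha beta; set B := powR (sqnorm _) _.
transitivity (B%:E * \int[mu]_(v in pos)
    (powR v (- N - 1) * f (S * powR v (- 1)))%:E).
  rewrite -ge0_integralZl//.
  - apply: eq_integral => v /[!inE] /posP v0; rewrite -EFinM; congr EFin.
    rewrite -(powR_inv1 (ltW v0)) -powR_invn ?(ltW v0)//.
    rewrite [LHS](_ : _ = B * (powR v (- (n%:R / 2)) * powR v (- 1) *
      powR v (- k%:R) * f (S * powR v (- 1))))%R; last by ring.
    rewrite -!powRD ?(gt_eqF v0) ?implybT//; congr (_ * (powR _ _ * _))%R.
    by rewrite /N; ring.
  - apply: measurable_funTS; measurability; apply: measurable_fun_radial => //.
    by measurability.
  - by move=> v _; rewrite lee_fin mulr_ge0 ?powR_ge0.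
  - by rewrite lee_fin powR_ge0.
by rewrite (radial_scaling mf f0 N (s_gt0 alpha beta)) muleA -EFinM [RHS]muleC mulrC.
Qed.

Let Z := sqnorm (X *m lse X y).
Let A := \int[mu]_x (expR (- (n%:R * x ^+ 2)))%:E.
Let GX := intRn (fun b : 'cV[R]_p => (expR (- sqnorm (X *m b)))%:E).

Let A_ge0 : 0 <= A.
Proof. by apply: integral_ge0 => x _; rewrite lee_fin expR_ge0. Qed.

Let GX_ge0 : 0 <= GX.
Proof. by apply: intRn_ge0 => v; rewrite lee_fin expR_ge0. Qed.

Section FixedExponents.
Variables N b : R.

(** What is left once [beta] has been integrated out, with the constant [GX] and the factor [E] in
    [alpha] split off. *)
Let D (h g : R) : R := (powR h (N - 1) * powR g (b - 1) * powR (g + h) (- (p%:R / 2)) *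
  expR (- (h * RSS X y + g * h * powR (g + h) (- 1) * Z)))%R.

Let D_ge0 h g : (0 <= D h g)%R.
Proof. by rewrite !mulr_ge0 ?powR_ge0 ?expR_ge0. Qed.

Let measurable_D :
  measurable_fun setT (fun z : measurableTypeR R * measurableTypeR R => (D z.1 z.2)%:E).
Proof. by rewrite /D; measurability. Qed.

Let measurable_Dh h : measurable_fun setT (fun g : measurableTypeR R => (D h g)%:E).
Proof.
have mg : measurable_fun setT (fun g : measurableTypeR R => (h : measurableTypeR R, g)).
  exact: measurable_fun_pair.
exact: (measurableT_comp measurable_D mg).
Qed.

Let D1 (h : R) := \int[mu]_(g in pos) (D h g)%:E.

Let D1_ge0 h : 0 <= D1 h.
Proof. by apply: integral_ge0 => g _; rewrite lee_fin. Qed.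

Let measurable_D1 : measurable_fun [set: R] D1.
Proof.
apply: (@ge0_measurable_integral_r _ _ _ _ _ mu pos (fun h g => (D h g)%:E)) => //.
Qed.

Let E (alpha h : R) := (expR (- (h * (n%:R * (alpha - ybar y) ^+ 2))))%:E.

Let E_ge0 alpha h : 0 <= E alpha h.
Proof. by rewrite lee_fin expR_ge0. Qed.

(** In the joint integrand [H], the variable [h] exponentiates the power of [s] and [g] the power of
    [|X beta|^2]. Two swaps bring [beta] innermost, where the integrand is Gaussian. *)
Let integrate_beta alpha :
  intRn (fun beta => Gamma N * (Gamma b * K N b alpha beta)) =
  GX * \int[mu]_(h in pos) (E alpha h * D1 h).
Proof.
have mKa := col_measurable_section alpha (measurable_K N b).
have GN0 := ltW (Gamma_gt0 N); have Gb0 := ltW (Gamma_gt0 b).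
pose H (h : R) (g : R) (beta : 'cV[R]_p) :=
  ((powR h (N - 1) * expR (- (s alpha beta * h))) *
   (powR g (b - 1) * expR (- (sqnorm (X *m beta) * g))))%:E.
have H0 h g beta : 0 <= H h g beta by rewrite lee_fin !mulr_ge0 ?powR_ge0 ?expR_ge0.
have ms2 d (T : measurableType d) : measurable_fun setT
    (fun z : T * p.-tuple R => s alpha (colt z.2)).
  have ma : measurable_fun setT (fun z : T * p.-tuple R => (alpha, z.2)).
    exact: measurable_fun_pair.
  exact: (measurableT_comp measurable_s ma).
have mq2 d (T : measurableType d) := @measurable_sqnorm_mulmx R d T p n X.
have mH3 : measurable_fun setT
    (fun z : (measurableTypeR R * measurableTypeR R) * p.-tuple R =>
      H z.1.1 z.1.2 (colt z.2)).
  have ? := ms2 _ (measurableTypeR R * measurableTypeR R)%type.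
  have ? := mq2 _ (measurableTypeR R * measurableTypeR R)%type.
  by rewrite /H; measurability.
have mH h : col_measurable (H h : measurableTypeR R -> _).
  have mg : measurable_fun setT (fun z : measurableTypeR R * p.-tuple R =>
      ((h : measurableTypeR R, z.1), z.2)).
    by apply: measurable_fun_pair => //; exact: measurable_fun_pair.
  exact: (measurableT_comp mH3 mg).
have mHg : col_measurable ((fun h beta => \int[mu]_(g in pos) H h g beta) :
    measurableTypeR R -> _).
  apply: (@ge0_measurable_integral_r _ _ _ _ _ mu pos
    (fun (z : measurableTypeR R * p.-tuple R) g => H z.1 g (colt z.2))) => //.
  have mg : measurable_fun setT
    (fun z : (measurableTypeR R * p.-tuple R) * measurableTypeR R =>
      ((z.1.1, z.2), z.1.2)).
    apply: measurable_fun_pair => //; last exact: measurableT_comp.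
    by apply: measurable_fun_pair => //; exact: measurableT_comp.
  exact: (measurableT_comp mH3 mg).
have Hg0 h beta : 0 <= \int[mu]_(g in pos) H h g beta.
  by apply: integral_ge0 => g _.
transitivity (intRn (fun beta => \int[mu]_(h in pos) \int[mu]_(g in pos) H h g beta)).
  (* At [beta = 0] the left-hand side contains [powR 0 (- b) = 0], while the
     integral over [g] diverges. *)
  apply: eq_intRn_off0 => //.
  - by apply: measurable_funeM; exact: measurable_funeM.
  - apply: (@ge0_measurable_integral_r _ _ _ _ _ mu pos
      (fun (t : p.-tuple R) h => \int[mu]_(g in pos) H h g (colt t))) => //.
    have mg : measurable_fun setT (fun z : p.-tuple R * measurableTypeR R =>
      (z.2, z.1)) by exact: measurable_fun_pair.
    exact: (measurableT_comp mHg mg).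
  - by move=> beta; rewrite !mule_ge0// K_ge0.
  - by move=> beta; exact: integral_ge0.
  move=> beta beta0.
  have q0 := sqnorm_mulmx_gt0 rX beta0.
  have S0 := s_gt0 alpha beta.
  transitivity (\int[mu]_(h in pos)
     ((powR h (N - 1) * expR (- (s alpha beta * h)))%:E *
      ((powR (sqnorm (X *m beta)) (- b))%:E * Gamma b))).
    rewrite ge0_integralZr//; last 3 first.
    - by apply: measurable_funTS; measurability.
    - by move=> h _; rewrite lee_fin mulr_ge0 ?powR_ge0 ?expR_ge0.
    - by rewrite mule_ge0// lee_fin powR_ge0.
    rewrite Gamma_scaling// /K EFinM.
    by rewrite [RHS]muleACA [LHS]muleA [LHS]muleC.
  apply: eq_integral => h _; rewrite /H.
  under [RHS]eq_integral do rewrite EFinM.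
  rewrite ge0_integralZl//.
  - by rewrite Gamma_scaling.
  - by apply: measurable_funTS; measurability.
  - by move=> g _; rewrite lee_fin mulr_ge0 ?powR_ge0 ?expR_ge0.
  - by rewrite lee_fin mulr_ge0 ?powR_ge0 ?expR_ge0.
rewrite -(intRn_swap mu _ mHg)//.
rewrite -ge0_integralZl//; last 2 first.
- apply: measurable_funTS; apply: emeasurable_funM; last exact: measurable_D1.
  by rewrite /E; measurability.
- by move=> h _; rewrite mule_ge0.
apply: eq_integral => h /[!inE] /posP h0.
rewrite -(intRn_swap mu _ (mH h))// /D1 muleA -ge0_integralZl//; last 3 first.
- by apply: measurable_funTS; exact: measurable_Dh.
- by move=> g _; rewrite lee_fin.
- exact: mule_ge0.
apply: eq_integral => g /[!inE] /posP g0.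
rewrite -muleA /E -EFinM.
set e := expR _.
transitivity ((powR h (N - 1) * powR g (b - 1) * (e * expR (- (h * RSS X y))))%:E *
   intRn (fun b : 'cV[R]_p => (expR (- (h * sqnorm (X *m (b - lse X y)) +
     g * sqnorm (X *m b))))%:E)).
  rewrite -intRnZl//.
  - apply: eq_intRn => beta; rewrite /H -EFinM; congr EFin.
    rewrite [LHS]mulrACA -[RHS]mulrA /e -!expRD; congr (_ * expR _)%R.
    by rewrite /s; ring.
  - by rewrite lee_fin !mulr_ge0 ?powR_ge0 ?expR_ge0.
  - have mr : measurable_fun setT (fun t : p.-tuple R =>
        sqnorm (X *m (colt t - lse X y))).
      have mg : measurable_fun setT (fun t : p.-tuple R => (0%R : measurableTypeR R, t)).
        exact: measurable_fun_pair.
      exact: (measurableT_comp measurable_r mg).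
    have mq1 := @measurable_sqnorm_mulmx0 R p n X.
    by rewrite /col_measurable0; measurability.
rewrite intRn_gauss_product// -/GX -/Z muleA muleC; congr (_ * _).
rewrite -EFinM; congr EFin; rewrite /D opprD expRD; ring.
Qed.

Let integrate_alpha :
  \int[mu]_alpha (GX * \int[mu]_(h in pos) (E alpha h * D1 h)) =
  A * GX * \int[mu]_(h in pos) ((powR h (- 2^-1))%:E * D1 h).
Proof.
rewrite ge0_integralZl//; last 2 first.
- apply: (@ge0_measurable_integral_r _ _ _ _ _ mu pos (fun alpha h => E alpha h * D1 h)) => //.
  + apply: emeasurable_funM; last exact: (measurableT_comp measurable_D1).
    by rewrite /E; under eq_fun do rewrite expr2; measurability.
  + by move=> alpha h; exact: mule_ge0.
- by move=> alpha _; apply: integral_ge0 => h _; exact: mule_ge0.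
rewrite [A * GX]muleC -muleA; congr (_ * _).
rewrite (@ge0_integral_swap _ _ _ _ _ mu mu setT pos (fun alpha h => E alpha h * D1 h))//; last 2 first.
- apply: emeasurable_funM; last exact: (measurableT_comp measurable_D1).
  by rewrite /E; under eq_fun do rewrite expr2; measurability.
- by move=> alpha h; exact: mule_ge0.
rewrite -ge0_integralZl//; last 2 first.
- apply: measurable_funTS; apply: emeasurable_funM; last exact: measurable_D1.
  by measurability.
- by move=> h _; rewrite mule_ge0// lee_fin powR_ge0.
apply: eq_integral => h /[!inE] /posP h0.
rewrite ge0_integralZr//; last first.
  by rewrite /E; under eq_fun do rewrite expr2; measurability.
by rewrite integral_gauss_centered// -/A [_ * A]muleC -muleA.
Qed.

Lemma Gamma_quadratic_integral_aux :
  Gamma N * (Gamma b * quadratic_integral N b) =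
  A * GX * \int[mu]_(h in pos) ((powR h (- 2^-1))%:E * D1 h).
Proof.
have GN0 := ltW (Gamma_gt0 N); have Gb0 := ltW (Gamma_gt0 b).
rewrite -integrate_alpha.
rewrite /quadratic_integral -ge0_integralZl//; last 2 first.
- exact: (measurable_intRn (measurable_K N b) (K_ge0 N b)).
- by move=> alpha _; apply: intRn_ge0; exact: (K_ge0 N b).
rewrite -ge0_integralZl//; last 2 first.
- apply: measurable_funeM.
  exact: (measurable_intRn (measurable_K N b) (K_ge0 N b)).
- by move=> alpha _; rewrite mule_ge0//; apply: intRn_ge0; exact: (K_ge0 N b).
apply: eq_integral => alpha _; rewrite -integrate_beta.
have mKa := col_measurable_section alpha (measurable_K N b).
have mGK : col_measurable0 (fun beta => Gamma b * K N b alpha beta).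
  exact: measurable_funeM.
rewrite (intRnZl GN0 mGK); last by move=> beta; exact: mule_ge0 Gb0 (K_ge0 N b alpha beta).
by rewrite (intRnZl Gb0 mKa (K_ge0 N b alpha)).
Qed.

End FixedExponents.

(** The shift [2^-1] offsets the [h^(-1/2)] produced by the integral over [alpha]. The condition on
    [b + c] matches the [(g + h)^(-p/2)] from the integral over [beta] with the kernel of
    [double_gamma_integral]. *)
Lemma Gamma_quadratic_integral (b c M : R) :
  (b + c = p%:R / 2)%R ->
  Gamma (M + c + 2^-1) * (Gamma b * quadratic_integral (M + c + 2^-1) b) =
  A * GX * (Gamma M * ((powR (RSS X y) (- M) *
    powR (RSS X y / (RSS X y + Z)) b)%:E *
    hyp_integral b c (M - (b + c)) (Z / (RSS X y + Z)))).
Proof.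
move=> bc; rewrite Gamma_quadratic_integral_aux; congr (_ * _).
rewrite -(double_gamma_integral b c M RSS0 (sqnorm_ge0 _)).
apply: eq_integral => h /[!inE] /posP h0.
rewrite -ge0_integralZl//; last 3 first.
- by apply: measurable_funTS; measurability.
- by move=> g _; rewrite lee_fin !mulr_ge0 ?powR_ge0 ?expR_ge0.
- by rewrite lee_fin powR_ge0.
apply: eq_integral => g _; rewrite -EFinM; congr EFin.
rewrite bc !mulrA -powRD ?(gt_eqF h0) ?implybT//.
by congr (powR _ _ * _ * _ * _)%R; field.
Qed.

End PosteriorIntegral.

(** * Assembly of the estimator *)

Section Assembly.
Variable R : realType.
Local Notation mu := (@lebesgue_measure R).
Local Open Scope ereal_scope.

(** Extracts from a product identity both the finiteness of an unknown factor and its value: an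
    infinite [y] would make the product infinite. *)
Lemma mule_eq_fin (x y : \bar R) (r : R) : 0 < x -> x < +oo -> 0 <= y ->
  x * y = r%:E -> y = (r / fine x)%:E.
Proof.
case: x => [x|//|//]; rewrite lte_fin => x0 _.
case: y => [y _ [<-]|_|//]; last by rewrite gt0_muley ?lte_fin.
by rewrite /= [(x * y)%R]mulrC mulfK// gt_eqF.
Qed.

Lemma gt0_fineK (x : \bar R) : 0 < x -> x < +oo -> exists2 r, (0 < r)%R & x = r%:E.
Proof. by case: x => [r|//|//]; rewrite lte_fin => r0 _; exists r. Qed.

Lemma Rintegral_hyp (b c e r2 : R) :
  Rintegral mu `[0%R, 1%R] (fun t =>
    powR t (b - 1) * powR (1 - t) (c - 1) * powR (1 - r2 * t) e)%R =
  fine (hyp_integral b c e r2).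
Proof.
rewrite /Rintegral /hyp_integral integral_itv_bndoo//.
by apply: measurable_funTS; measurability.
Qed.

(** [E|eps|^2] is the trace of the variance matrix [I_n]. *)
Lemma intRn_second_moment n (f : R -> R) :
  measurable_fun [set: R] f -> (forall t, (0 <= f t)%R) ->
  (forall i : 'I_n, intRn (fun e : 'cV[R]_n => (e i 0 * e i 0 * f (sqnorm e))%:E) = 1) ->
  intRn (fun e : 'cV[R]_n => (f (sqnorm e) * sqnorm e ^+ 1)%:E) = n%:R%:E.
Proof.
move=> mf f0 vf.
transitivity (intRn (fun e : 'cV[R]_n =>
    \sum_(i < n) (e i ord0 * e i ord0 * f (sqnorm e))%:E)).
  apply: eq_intRn => e; rewrite sumEFin expr1 mulrC -big_distrl/=.
  by congr (_ * _)%:E; apply: eq_bigr => i _; rewrite expr2.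
rewrite intRn_sum.
- by rewrite (eq_bigr (fun=> 1%:E)) => [|i _]; rewrite ?vf// sumEFin sumr_const card_ord.
- move=> i; rewrite /col_measurable0.
  have ms := @measurable_sqnorm0 R n.
  have mi : measurable_fun setT (fun s : n.-tuple R => colt s i ord0).
    by under eq_fun do rewrite mxE; exact: measurable_tnth.
  by measurability; apply: measurable_fun_radial.
- by move=> i e; rewrite lee_fin mulr_ge0// -expr2 sqr_ge0.
Qed.

End Assembly.

Theorem theorem2p2 (R : realType) (n p : nat) (X : 'M[R]_(n, p))
  (f : R -> R) (a : R) (y : 'cV[R]_n) :
  (* design: centered, full column rank, n > p + 1 *)
  (p.+1 < n)%N ->
  (ones R n)^T *m X = 0 ->
  \rank X = p ->
  (* spherically symmetric error density f(e'e) on R^n *)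
  measurable_fun setT f ->
  (forall t, 0 <= f t) ->
  intRn (fun e : 'cV[R]_n => (f (sqnorm e))%:E) = 1%E ->
  (* E[eps] = 0 *)
  (forall i : 'I_n,
     (intRn (fun e : 'cV[R]_n => (`|e i 0| * f (sqnorm e))%:E) < +oo)%E /\
     intRn (fun e : 'cV[R]_n => (e i 0 * f (sqnorm e))%:E) = 0%E) ->
  (* Var[eps] = I_n *)
  (forall i j : 'I_n,
     (intRn (fun e : 'cV[R]_n => (`|e i 0 * e j 0| * f (sqnorm e))%:E) < +oo)%E /\
     intRn (fun e : 'cV[R]_n => (e i 0 * e j 0 * f (sqnorm e))%:E)
       = ((i == j)%:R)%:E) ->
  0 < a -> a < p%:R ->
  (* y is not in the column span of (1_n, X), i.e. RSS > 0 *)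
  0 < RSS X y ->
  [/\ post_int X y f a 0 \is a fin_num, post_int X y f a 1 \is a fin_num,
      (0 < post_int X y f a 1)%E &
      delta_GB X y f a = phi_GB n p a (Rsq X y) * (RSS X y / (n%:R - p%:R - 1))].
Proof.
move=> pn X1 rX mf f0 f1 _ vf a0 ap S0.
have p0 : (0 < p)%N by rewrite -(ltr_nat R); exact: lt_trans ap.
have n0 : (0 < n)%N by exact: ltn_trans pn.
have pnR : p%:R + 1 < n%:R :> R by rewrite natr1 ltr_nat.
have nR0 : 0 < n%:R :> R by rewrite ltr0n.
set S := RSS X y in S0 *.
set Z := sqnorm (X *m lse X y).
have Z0 : 0 <= Z by exact: sqnorm_ge0.
have RsqE : Rsq X y = Z / (S + Z).
  by rewrite /Rsq -(mulmx_lse X y) (sqnorm_ycent y rX).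
pose b := (p%:R - a) / 2; pose c := a / 2.
have b0 : 0 < b by rewrite divr_gt0// subr_gt0.
have c0 : 0 < c by rewrite divr_gt0.
have bc : b + c = p%:R / 2 by rewrite /b /c; field.
(* Chosen so that [M + c + 1/2 = n/2]; then [2 M] is the [n - a - 1] of [phi_GB], positive because
   [a < p < n - 1]. *)
pose M : R := (n%:R - 1 - a) / 2.
have M0 : 0 < M by rewrite divr_gt0//; lra.
have N0 : 0 < n%:R / 2 :> R by rewrite divr_gt0.
(* The exponent [M + k - (b + c)] is [(n-p-a-1)/2] at [k = 0] and [(n-p-a+1)/2] at [k = 1], as in
   the two integrals of [phi_GB]. *)
pose I (k : nat) := hyp_integral b c (M + k%:R - (b + c)) (Z / (S + Z)).
have [A A0 AE] : exists2 r, 0 < r &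
    (\int[@lebesgue_measure R]_x (expR (- (n%:R * x ^+ 2)))%:E)%E = r%:E.
  apply: gt0_fineK; last exact: integral_gauss_scaled.
  have muT : @lebesgue_measure R [set: R] != 0%E.
    by rewrite -set_itvNyy lebesgue_measure_itv.
  apply: integral_gt0 => //.
  - by under eq_fun do rewrite expr2; measurability.
  - by move=> x _; rewrite lte_fin expR_gt0.
have [k k0 kX] := sqnorm_mulmx_ge rX.
have mX := @measurable_sqnorm_mulmx0 R p n X.
have mXE : col_measurable0 (fun v : 'cV[R]_p => (expR (- sqnorm (X *m v)))%:E).
  by rewrite /col_measurable0; measurability.
have [GX GX0 GXE] : exists2 r, 0 < r &
    intRn (fun v : 'cV[R]_p => (expR (- sqnorm (X *m v)))%:E) = r%:E.
  apply: gt0_fineK.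
    by apply: intRn_gt0 => // v; rewrite lte_fin expR_gt0.
  apply: le_lt_trans (@intRn_gauss_lty R p k k0); apply: le_intRn => //.
  - have ? := @measurable_sqnorm0 R p.
    by rewrite /col_measurable0; measurability.
  - by move=> v; rewrite lee_fin ler_expR lerN2.
have mGn : col_measurable0 (fun v : 'cV[R]_n => (expR (- sqnorm v))%:E).
  have ? := @measurable_sqnorm0 R n.
  by rewrite /col_measurable0; measurability.
have [Gn Gn0 GnE] : exists2 r, 0 < r &
    intRn (fun v : 'cV[R]_n => (expR (- sqnorm v))%:E) = r%:E.
  apply: gt0_fineK.
    by apply: intRn_gt0 => // v; rewrite lte_fin expR_gt0.
  have := @intRn_gauss_lty R n 1 ltr01.
  by under eq_intRn do rewrite mul1r.
have GammaE (x : R) : 0 < x -> exists2 r, 0 < r & Gamma x = r%:E.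
  by move=> x0; apply: gt0_fineK; [exact: Gamma_gt0 | exact: Gamma_lty].
have [gn gn0 gnE] := GammaE _ N0.
have [gb gb0 gbE] := GammaE _ b0.
have [gM gM0 gME] := GammaE _ M0.
have IE j : exists2 r, 0 < r & I j = r%:E.
  by apply: gt0_fineK; [exact: hyp_integral_gt0 | exact: hyp_integral_lty].
have [I0 I0_gt0 I0E] := IE 0; have [I1 I1_gt0 I1E] := IE 1.
(* The value of [Q_j], and with it its finiteness, by division by [Gamma (n/2 + j)] and
   [Gamma b]. *)
have JE j (gN gMj Ij : R) : 0 < gN -> Gamma (n%:R / 2 + j%:R) = gN%:E ->
    Gamma (M + j%:R) = gMj%:E -> I j = Ij%:E ->
    quadratic_integral X y (n%:R / 2 + j%:R) b =
    (A * GX * (gMj * (powR S (- (M + j%:R)) * powR (S / (S + Z)) b * Ij)) / gN / gb)%:E.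
  move=> gN0 gNE gMjE IjE.
  have := Gamma_quadratic_integral p0 rX S0 (M + j%:R) bc.
  rewrite (_ : M + j%:R + c + 2^-1 = n%:R / 2 + j%:R); last by rewrite /M /c; field.
  rewrite gNE gbE gMjE AE GXE -/Z -/S -/(I j) IjE muleA -EFinM => E.
  have Q0 : (0 <= quadratic_integral X y (n%:R / 2 + j%:R) b)%E.
    apply: integral_ge0 => alpha _; apply: intRn_ge0 => beta.
    by rewrite lee_fin mulr_ge0 ?powR_ge0.
  rewrite (mule_eq_fin _ _ Q0 E) ?ltry ?lte_fin ?mulr_gt0//=.
  by congr EFin; field; rewrite !gt_eqF.
(* [P_j] is the moment [m] of order [j] of [|eps|^2] times a constant [gn / Gn] common to [j = 0]
   and [j = 1]. *)
have PE j (m : R) : intRn (fun e : 'cV[R]_n => (f (sqnorm e) * sqnorm e ^+ j)%:E) = m%:E ->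
    radial_mass f (n%:R / 2 + j%:R) = (gn * m / Gn)%:E.
  move=> mE; have := radial_mass_moment mf f0 j n0.
  rewrite GnE gnE mE muleC -EFinM => E.
  by rewrite (mule_eq_fin _ _ (radial_mass_ge0 f0 _) E) ?ltry ?lte_fin.
have m0 : intRn (fun e : 'cV[R]_n => (f (sqnorm e) * sqnorm e ^+ 0)%:E) = 1%:E.
  by rewrite -[RHS]f1; apply: eq_intRn => e; rewrite expr0 mulr1.
have m1 := intRn_second_moment mf f0 (fun i => etrans (vf i i).2
  (congr1 (fun t : bool => t%:R%:E) (eqxx i))).
have gN0E : Gamma (n%:R / 2 + 0%:R) = gn%:E by rewrite addr0.
have gN1E : Gamma (n%:R / 2 + 1%:R) = (n%:R / 2 * gn)%:E by rewrite GammaS// gnE.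
have gM0E : Gamma (M + 0%:R) = gM%:E by rewrite addr0.
have gM1E : Gamma (M + 1%:R) = (M * gM)%:E by rewrite GammaS// gME.
have gN1_gt0 : 0 < n%:R / 2 * gn by rewrite mulr_gt0.
have post0 := post_int_factor n0 X1 rX S0 a 0 mf f0.
have post1 := post_int_factor n0 X1 rX S0 a 1 mf f0.
rewrite (PE 0 _ m0) (JE 0 _ _ _ gn0 gN0E gM0E I0E) -EFinM in post0.
rewrite (PE 1 _ m1) (JE 1 _ _ _ gN1_gt0 gN1E gM1E I1E) -EFinM in post1.
have SZ0 : 0 < S + Z by rewrite ltr_wpDr.
have w0 : 0 < powR (S / (S + Z)) b by apply: powR_gt0; exact: divr_gt0.
have q0 : 0 < powR S (- M) by exact: powR_gt0.
(* The extra [1 / S] at [k = 1] becomes the factor [RSS] of the estimator. *)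
have SM1 : powR S (- (M + 1%:R)) = powR S (- M) / S.
  rewrite opprD powRD; last by rewrite (gt_eqF S0) implybT.
  by rewrite powR_inv1 ?ltW.
rewrite SM1 in post1; rewrite addr0 in post0.
split.
- by rewrite post0.
- by rewrite post1.
- rewrite post1 lte_fin.
  by repeat first [assumption | apply: divr_gt0 | apply: mulr_gt0].
rewrite /delta_GB post0 post1 /= /phi_GB.
have R0 : Rintegral (@lebesgue_measure R) `[0, 1] (fun t =>
    powR t (p%:R / 2 - a / 2 - 1) * powR (1 - t) (a / 2 - 1) *
    powR (1 - Rsq X y * t) ((n%:R - p%:R - a - 1) / 2)) = I0.
  rewrite -[RHS]/(fine I0%:E) -I0E /I -Rintegral_hyp -RsqE.
  congr Rintegral; apply/funext => t.
  by congr (powR _ _ * _ * powR _ _); rewrite /M /b /c; field.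
have R1 : Rintegral (@lebesgue_measure R) `[0, 1] (fun t =>
    powR t (p%:R / 2 - a / 2 - 1) * powR (1 - t) (a / 2 - 1) *
    powR (1 - Rsq X y * t) ((n%:R - p%:R - a + 1) / 2)) = I1.
  rewrite -[RHS]/(fine I1%:E) -I1E /I -Rintegral_hyp -RsqE.
  congr Rintegral; apply/funext => t.
  by congr (powR _ _ * _ * powR _ _); rewrite /M /b /c; field.
rewrite R0 R1 -/S /M.
have ? : n%:R - p%:R - 1 != 0 :> R by rewrite gt_eqF//; lra.
have ? : n%:R - a - 1 != 0 :> R by rewrite gt_eqF//; lra.
have ? : n%:R - 1 - a != 0 :> R by rewrite gt_eqF//; lra.
(* Both sides equal [S * I0 / ((n - a - 1) * I1)]. *)
field.
by repeat (apply/andP; split); first [assumption | exact: lt0r_neq0].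
Qed.
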